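(* Let $1<p<\infty$. Let $f\colon \mathbb{T}_n\times\mathbb{R}^m\to\mathbb{R}$ be a measurable integrand such that, for constants $\nu,c$, $$|w|^p\le f(x,w)\le \nu |w|^p+c\qquad\text{for all } w\in\mathbb{R}^m \text{ and a.e. } x\in\mathbb{T}_n .$$ Suppose that the differential operator $\mathscr{A}$ satisfies the truncation property (TP) with exponent $p$ and constant $C(\mathscr{A})$. Let $u\in L^p(\mathbb{T}_n;\mathbb{R}^m)$ be a minimiser, over $L^p(\mathbb{T}_n;\mathbb{R}^m)$, of the functional $$I(u)=\begin{cases}\int_{\mathbb{T}_n} f(x,u(x))\,\mathrm{d}x & \text{if }\mathscr{A}u=0,\\ \infty&\text{else.}\end{cases}$$ Then there is an $\varepsilon_0=\varepsilon_0(p,C(\mathscr{A}),\nu)>0$ such that $u\in L^{p+\varepsilon}(\mathbb{T}_n;\mathbb{R}^m)$ for all $0<\varepsilon<\varepsilon_0$.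
   Context: $\mathbb{T}_n$ is the $n$-dimensional torus $\mathbb{R}^n/\mathbb{Z}^n$; the dimensions $n,m,l$ are fixed. Measurability of $f$ is understood so that $x\mapsto f(x,v(x))$ is measurable for every measurable $v$. $\mathscr{A}$ is a linear homogeneous constant-coefficient differential operator $\mathscr{A}u=\sum_{|\alpha|=k}A_\alpha\partial^\alpha u$ with linear maps $A_\alpha\colon\mathbb{R}^m\to\mathbb{R}^l$. For $u\in L^p$, the equation $\mathscr{A}u=0$ is understood in the distributional sense: $\int_{\mathbb{T}_n} u\cdot\mathscr{A}^*\varphi\,\mathrm{d}x=0$ for all $\varphi\in C^\infty(\mathbb{T}_n;\mathbb{R}^l)$, where $\mathscr{A}^*\varphi=\sum_{|\alpha|=k}A_\alpha^T\partial^\alpha\varphi$. Maximal function: $\mathscr{M}u(x)=\sup_{r>0}\frac{1}{\mathcal{L}^n(B_r(x))}\int_{B_r(x)}|u|\,\mathrm{d}y$, where $u\in L^1(\mathbb{T}_n;\mathbb{R}^m)$ is regarded as a $\mathbb{Z}^n$-periodic function on $\mathbb{R}^n$. Truncation property (TP) with exponent $p$: there is a constant $C(\mathscr{A})$ such that for any $u\in L^p(\mathbb{T}_n;\mathbb{R}^m)$ with $\mathscr{A}u=0$ and any $\lambda>0$ there exists $\tilde u\in L^\infty(\mathbb{T}_n;\mathbb{R}^m)$ with $\mathscr{A}\tilde u=0$, $\|\tilde u\|_{L^\infty}\le C(\mathscr{A})\lambda$, and $\{u\neq\tilde u\}\subset\{\mathscr{M}u\ge\lambda\}$ (up to null sets).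 *)

(* Defs.v *)
From HB Require Import structures.
From mathcomp Require Import all_boot all_order all_algebra.
From mathcomp Require Import all_classical all_reals all_analysis.
Import Order.TTheory GRing.Theory Num.Theory.
Import numFieldNormedType.Exports.

Set Implicit Arguments.
Unset Strict Implicit.
Unset Printing Implicit Defensive.

Local Open Scope classical_set_scope.
Local Open Scope ring_scope.
Local Open Scope ereal_scope.

(* The sigma-algebra on 'rV[T]_n generated by the coordinates: for T = R, the
   Borel sigma-algebra of R^n. *)
Definition measure_rV_display : measure_display -> measure_display.
Proof. exact. Qed.

Section measurable_rV.
Context {d} {T : sigmaRingType d}.
Variable n : nat.

Let coors : 'I_n -> 'rV[T]_n -> T := fun i x => x ord0 i.

Let rV_set0 : g_sigma_preimage coors set0.
Proof. exact: sigma_algebra0. Qed.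

Let rV_setC A : g_sigma_preimage coors A -> g_sigma_preimage coors (~` A).
Proof. exact: sigma_algebraC. Qed.

Let rV_bigcup (F : _^nat) : (forall i, g_sigma_preimage coors (F i)) ->
  g_sigma_preimage coors (\bigcup_i (F i)).
Proof. exact: sigma_algebra_bigcup. Qed.

HB.instance Definition _ := @isMeasurable.Build (measure_rV_display d)
  'rV[T]_n (g_sigma_preimage coors) rV_set0 rV_setC rV_bigcup.

End measurable_rV.

Lemma measurable_coord d (T : sigmaRingType d) n (i : 'I_n) :
  measurable_fun [set: 'rV[T]_n] (fun x => x ord0 i).
Proof.
move=> _ Y mY; rewrite setTI; apply: sub_sigma_algebra => /=.
rewrite -bigcup_seq/=; exists i => /=; first by rewrite mem_index_enum.
by exists Y => //; rewrite setTI.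
Qed.

Lemma measurable_fun_coordP d1 d2 (T1 : measurableType d1)
    (T2 : sigmaRingType d2) n (f : T1 -> 'rV[T2]_n) :
  measurable_fun [set: T1] f <->
  forall i, measurable_fun [set: T1] (fun x => f x ord0 i).
Proof.
split=> [mf i _ Y mY|mf _ Y mY].
  by have := mf measurableT _ (measurable_coord i measurableT mY); rewrite !setTI.
rewrite setTI; move: Y mY.
suff : (measurable : set_system 'rV[T2]_n) `<=`
    [set Y | measurable (f @^-1` Y)] by [].
apply: smallest_sub.
  split => /=.
  - by rewrite preimage_set0.
  - by move=> A mA; rewrite setTD preimage_setC; exact: measurableC.
  - by move=> A mA; rewrite preimage_bigcup; exact: bigcup_measurable.
move=> Y; rewrite -bigcup_seq/= => -[i _ [B mB <-]] /=.
by rewrite setTI -comp_preimage -[X in measurable X]setTI; exact: mf.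
Qed.

Section lebesgue_rV.
Context {R : realType}.

Definition rV_cons n (p : measurableTypeR R * 'rV[R]_n) : 'rV[R]_n.+1 :=
  \row_i oapp (fun j => p.2 ord0 j) p.1 (unlift ord0 i).

Lemma measurable_rV_cons n : measurable_fun [set: _] (@rV_cons n).
Proof.
apply/measurable_fun_coordP => i.
under eq_fun do rewrite mxE.
case: (unliftP ord0 i) => [j _|_] /=.
- exact: (measurableT_comp (measurable_coord j)).
- exact: measurable_fst.
Qed.

Section lebesgue_rV_succ.
Variables (n : nat) (mu : {sigma_finite_measure set 'rV[R]_n -> \bar R}).

Definition lebesgue_rV_succ : set 'rV[R]_n.+1 -> \bar R :=
  pushforward (@lebesgue_measure R \x mu) (@rV_cons n).

Let prod_measure : {measure set (measurableTypeR R * 'rV[R]_n) -> \bar R} :=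
  (@lebesgue_measure R \x mu).

HB.instance Definition _ := Measure.copy lebesgue_rV_succ
  (measure_function_pushforward__canonical__measure_function_Measure
     prod_measure (@measurable_rV_cons n)).

Let sigma_finite_lebesgue_rV_succ :
  sigma_finite [set: 'rV[R]_n.+1] lebesgue_rV_succ.
Proof.
have /sigma_finiteP[F [FT ndF Foo]] := sigma_finiteT (@lebesgue_measure R).
have /sigma_finiteP[G [GT ndG Goo]] := sigma_finiteT mu.
pose un (x : 'rV[R]_n.+1) : measurableTypeR R * 'rV[R]_n :=
  (x ord0 ord0, \row_j x ord0 (lift ord0 j)).
have consK : cancel (@rV_cons n) un.
  case=> a v; congr pair; first by rewrite mxE unlift_none.
  by apply/rowP => j; rewrite !mxE liftK.
have mun : measurable_fun [set: _] un.
  apply/measurable_fun_pairP; split; first exact: measurable_coord.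
  by apply/measurable_fun_coordP => i /=; under eq_fun do rewrite mxE;
    exact: measurable_coord.
exists (fun k => un @^-1` (F k `*` G k)).
  rewrite predeqE => x; split => // _.
  have [k _ Fk] : (\bigcup_k F k) (un x).1 by rewrite -FT.
  have [l _ Gl] : (\bigcup_k G k) (un x).2 by rewrite -GT.
  exists (maxn k l) => //; split.
  - by move: Fk; exact/subsetPset/ndF/leq_maxl.
  - by move: Gl; exact/subsetPset/ndG/leq_maxr.
move=> k; have [mF Ffin] := Foo k; have [mG Gfin] := Goo k; split.
  by rewrite -[X in measurable X]setTI; apply: mun => //; exact: measurableX.
rewrite /lebesgue_rV_succ /pushforward -comp_preimage.
rewrite (_ : un \o _ = idfun); last by apply/funext => x /=; rewrite consK.
by rewrite preimage_id product_measure1E// lte_mul_pinfty// ge0_fin_numE.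
Qed.

HB.instance Definition _ := @Measure_isSigmaFinite.Build _ _ _
  lebesgue_rV_succ sigma_finite_lebesgue_rV_succ.

End lebesgue_rV_succ.

(* Lebesgue measure on the Borel sets of R^n, as an iterated product; on the
   one-point space R^0 it is the unit mass. *)
Fixpoint borel_lebesgue_rV n : {sigma_finite_measure set 'rV[R]_n -> \bar R} :=
  if n is n'.+1 then lebesgue_rV_succ (borel_lebesgue_rV n')
  else \d_(0%R : 'rV[R]_0).

End lebesgue_rV.

(* R^n with the sigma-algebra of Lebesgue (Caratheodory) measurable sets. *)
Notation lebesgue_rV_type R n :=
  (caratheodory_type ((@borel_lebesgue_rV R n)^*)%mu).

Section torus_measure.
Variables (R : realType) (n : nat).

(* Lebesgue measure on the Lebesgue measurable sets of R^n. *)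
Definition lebesgue_rV : set (lebesgue_rV_type R n) -> \bar R :=
  @completed_measure_extension _ _ _ (@borel_lebesgue_rV R n).

HB.instance Definition _ := Measure.on lebesgue_rV.

Definition unit_cube : set (lebesgue_rV_type R n) :=
  [set x : 'rV[R]_n | forall i, (0 <= x ord0 i < 1)%R].

Lemma measurable_unit_cube : measurable unit_cube.
Proof.
apply: caratheodory_measurable_mu_ext.
rewrite (_ : unit_cube = \big[setI/setT]_(i < n)
  ((fun x : 'rV[R]_n => x ord0 i) @^-1` `[0%R, 1%R[)).
  apply: bigsetI_measurable => i _.
  by rewrite -[X in measurable X]setTI; exact: measurable_coord.
rewrite -bigcap_seq; apply/seteqP; split => x /= xI i.
  by move=> _; rewrite /= in_itv/=; exact: xI.
by have := xI i; rewrite /= in_itv/=; apply; rewrite mem_index_enum.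
Qed.

(* Functions on the torus R^n/Z^n are Z^n-periodic functions on R^n, and the
   measure of the torus is carried by the fundamental domain [0, 1)^n. *)
Definition torus_measure : set (lebesgue_rV_type R n) -> \bar R :=
  mrestr lebesgue_rV measurable_unit_cube.

HB.instance Definition _ := Measure.on torus_measure.

End torus_measure.
Arguments lebesgue_rV R n : clear implicits.
Arguments torus_measure R n : clear implicits.

Definition torus_periodic (R : realType) (n : nat) (T : Type) (g : 'rV[R]_n -> T) :=
  forall (x : 'rV[R]_n) (z : 'rV[int]_n), g (x + map_mx intr z)%R = g x.

Section euclidean.
Variables (R : realType) (m : nat).
Implicit Types v w : 'rV[R]_m.

Definition dotp v w : R := (\sum_j v ord0 j * w ord0 j)%R.

(* The library norm on 'rV is the maximum norm. *)
Definition enorm v : R := Num.sqrt (dotp v v).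

End euclidean.

Section function_spaces.
Variables (R : realType) (n m : nat).
Implicit Types u : 'rV[R]_n -> 'rV[R]_m.

Definition lebesgue_measurable u :=
  forall j, measurable_fun [set: lebesgue_rV_type R n]
    (fun x : lebesgue_rV_type R n => u x ord0 j).

Definition Lp_norm (p : \bar R) u : \bar R :=
  Lnorm (torus_measure R n) p
    (fun x : lebesgue_rV_type R n => (enorm (u x))%:E).

Definition in_Lp (p : \bar R) u :=
  [/\ torus_periodic u, lebesgue_measurable u & Lp_norm p u < +oo].

Definition eball (x : 'rV[R]_n) (r : R) : set (lebesgue_rV_type R n) :=
  [set y : 'rV[R]_n | (enorm (y - x) < r)%R].

Definition maximal_function u (x : 'rV[R]_n) : \bar R :=
  ereal_sup [set (lebesgue_rV R n (eball x r))^-1 *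
                 \int[lebesgue_rV R n]_(y in eball x r) (enorm (u y))%:E
            | r in [set r : R | (0 < r)%R]].

End function_spaces.

Section smooth.
Variables (R : realType) (n l : nat).
Implicit Types phi : 'rV[R]_n -> 'rV[R]_l.

Definition iter_partial (s : seq 'I_n) phi : 'rV[R]_n -> 'rV[R]_l :=
  foldr (fun i psi x => 'D_(delta_mx ord0 i) psi x) phi s.

Definition smooth phi := forall s : seq 'I_n,
  continuous (iter_partial s phi) /\
  forall i x, derivable (iter_partial s phi) x (delta_mx ord0 i).

Definition multi_index k :=
  {a : {ffun 'I_n -> 'I_k.+1} | (\sum_i a i == k)%N}.

(* The order of the derivatives is immaterial on smooth functions. *)
Definition partial k (a : multi_index k) phi : 'rV[R]_n -> 'rV[R]_l :=
  iter_partial (flatten [seq nseq (val a i) i | i <- enum 'I_n]) phi.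

End smooth.

Section differential_operator.
Variables (R : realType) (n m l k : nat).

(* The operator \sum_(|a| = k) A_a \partial^a is given by its coefficients
   A_a : R^m -> R^l, as matrices acting on column vectors. *)
Definition diff_op := multi_index n k -> 'M[R]_(l, m).

Implicit Types (A : diff_op) (u : 'rV[R]_n -> 'rV[R]_m).

(* On row vectors, w *m A a is the transpose of A_a^T w. *)
Definition adjoint_op A (phi : 'rV[R]_n -> 'rV[R]_l) (x : 'rV[R]_n) :
    'rV[R]_m :=
  (\sum_(a : multi_index n k) partial a phi x *m A a)%R.

Definition A_free A u :=
  forall phi : 'rV[R]_n -> 'rV[R]_l, torus_periodic phi -> smooth phi ->
  \int[torus_measure R n]_x (dotp (u x) (adjoint_op A phi x))%:E = 0.

Definition truncation_property A (p C : R) :=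
  forall u (lambda : R), in_Lp p%:E u -> A_free A u -> (0 < lambda)%R ->
  exists u' : 'rV[R]_n -> 'rV[R]_m,
    [/\ in_Lp +oo u', A_free A u', Lp_norm +oo u' <= (C * lambda)%:E &
      {ae torus_measure R n, forall x : lebesgue_rV_type R n,
        u x <> u' x -> lambda%:E <= maximal_function u x}].

Definition integrand_measurable (f : 'rV[R]_n -> 'rV[R]_m -> R) :=
  forall v : 'rV[R]_n -> 'rV[R]_m, torus_periodic v -> lebesgue_measurable v ->
  measurable_fun [set: lebesgue_rV_type R n]
    (fun x : lebesgue_rV_type R n => f x (v x)).

Definition energy A (f : 'rV[R]_n -> 'rV[R]_m -> R) u : \bar R :=
  if `[< A_free A u >] then \int[torus_measure R n]_x (f x (u x))%:E else +oo.

Definition minimiser A f (p : R) u :=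
  in_Lp p%:E u /\ forall v, in_Lp p%:E v -> energy A f u <= energy A f v.

End differential_operator.

(* Main.v *)
(* If the truncation at level l is used as a competitor, minimality and growth
   give int_{|u| > C l} |u|^p <= (nu (C l)^p + |c|) |{M u >= l}|; large l absorbs
   c. The weak-type bound l |{M u >= l}| <= K int_{|u| > l/4} |u|, valid for l
   large, turns this into int_{|u| > C l} |u|^p <= K' l^(p-1) int_{|u| > l/4} |u|.
   Summing over the dyadic levels l = 2^j l0, j < J, with weights 2^(j eps), the
   left-hand side is about (2^eps - 1)^-1 int |u|^p min(|u|, 2^J)^eps, and the
   right-hand side at most a constant times that integral, so for small eps it is
   absorbed. The bound is uniform in J, and eps depends only on the constants. *)
Require Import Defs.
From mathcomp Require Import all_boot all_order all_algebra.
From mathcomp Require Import all_classical all_reals all_analysis.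
From mathcomp Require Import measurable_realfun ess_sup_inf.
From mathcomp Require Import ring lra.
Import Order.TTheory GRing.Theory Num.Theory.
Import numFieldNormedType.Exports.

Set Implicit Arguments.
Unset Strict Implicit.
Unset Printing Implicit Defensive.

Local Open Scope classical_set_scope.
Local Open Scope ring_scope.

(** * Lebesgue measure of boxes and translation invariance *)

Section borel_lebesgue.
Context {R : realType}.
Local Open Scope ereal_scope.

(** The maximal function averages over balls of R^n of every radius, while mass is counted on one
    unit cube. Periodicity reconciles the two: an average over a ball of radius above 1 is at most a
    dimensional multiple of the mass of one period, so at large levels only small balls matter, and
    these stay within a fixed number of cells. Covering by cubes with rational centres and radii
    keeps the family countable, which gives a measurable superset of the level set and reduces
    Vitali's selection to finite lists. In the comparison of energies, the contributions off the set
    where [u] and its truncation differ are cancelled; this is legitimate because the truncation is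
    bounded and the torus has finite measure. The truncation constant enters only through a power
    [2 ^+ s] above [4 * |C|]: the two thresholds of the level-set inequality are then [s] dyadic
    levels apart, and this shift costs a factor [e ^+ s] with e = 2^eps, which stays below 2^s for
    eps < 1. *)

Lemma measurable_box n (A : 'I_n -> set (measurableTypeR R)) :
  (forall i, measurable (A i)) ->
  measurable [set y : 'rV[R]_n | forall i, A i (y ord0 i)].
Proof.
move=> mA; rewrite (_ : [set _ | _] = \bigcap_(i in setT)
    ((fun y : 'rV[R]_n => y ord0 i) @^-1` A i)).
  apply: fin_bigcap_measurable => [//|i _].
  by rewrite -[X in measurable X]setTI; exact: (measurable_coord i measurableT (mA i)).
apply/seteqP; split=> y yA i; first by move=> _; exact: yA.
exact: yA i I.
Qed.

Lemma borel_lebesgue_box n (A : 'I_n -> set (measurableTypeR R)) (a : R) :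
  (forall i, measurable (A i)) -> (forall i, lebesgue_measure (A i) = a%:E) ->
  borel_lebesgue_rV n [set y : 'rV[R]_n | forall i, A i (y ord0 i)] =
  (a ^+ n)%:E.
Proof.
elim: n A => [|n IH] A mA muA.
  by rewrite /= diracE expr0 mem_set//=; case.
rewrite /= /lebesgue_rV_succ /pushforward.
rewrite (_ : _ @^-1` _ = A ord0 `*`
    [set y : 'rV[R]_n | forall i, A (lift ord0 i) (y ord0 i)]).
  rewrite product_measure1E//; last exact: (@measurable_box _ (fun i => A (lift ord0 i))).
  by rewrite exprS EFinM; congr (_ * _); [exact: muA|exact: (IH (fun i => A (lift ord0 i)))].
apply/seteqP; split => [[x y] /= xyA|[x y] /= [xA yA] i].
  split=> [|i]; first by have := xyA ord0; rewrite mxE unlift_none.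
  by have := xyA (lift ord0 i); rewrite mxE liftK.
by rewrite mxE; case: unliftP => [j ->|->] /=.
Qed.

Lemma lebesgue_measure_translate (a : R) (A : set (measurableTypeR R)) :
  measurable A ->
  lebesgue_measure ((fun x : R => (x + a)%R) @^-1` A) = lebesgue_measure A.
Proof.
move=> mA.
have mT : measurable_fun [set: measurableTypeR R]
    (fun x : R => (x + a)%R : measurableTypeR R) by exact: measurable_funD.
apply/esym/(@lebesgue_measure_unique _ (pushforward lebesgue_measure
  (fun x : R => (x + a)%R : measurableTypeR R))) => // _ [[b c]] _ <-.
have TE : (fun x : R => (x + a)%R) @^-1` `]b, c]%classic = `](b - a)%R, (c - a)%R]%classic.
  by apply/seteqP; split => x /=; rewrite !in_itv/= ltrBlDr lerBrDr.
rewrite /= /pushforward TE !lebesgue_measure_itv/= !lte_fin ltrBlDr subrK.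
by case: ifP => // _; rewrite -!EFinB opprB addrA subrK.
Qed.

Lemma measurable_rV_translate n (z : 'rV[R]_n) :
  measurable_fun [set: 'rV[R]_n] (fun x : 'rV[R]_n => (x + z)%R).
Proof.
apply/measurable_fun_coordP => i; under eq_fun do rewrite mxE.
by apply: measurable_funD => //; exact: measurable_coord.
Qed.

(** Induction on the dimension: a translation acts separately on the two factors, so the translated
    measure and the product measure agree on rectangles, and uniqueness of the product measure does
    the rest. *)
Lemma borel_lebesgue_translate n (z : 'rV[R]_n) (A : set 'rV[R]_n) :
  measurable A ->
  borel_lebesgue_rV n ((fun x : 'rV[R]_n => (x + z)%R) @^-1` A) =
  borel_lebesgue_rV n A.
Proof.
elim: n z A => [|n IH] z A mA.
  rewrite (_ : (fun x => _) = id) ?preimage_id//.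
  by apply/funext => x; apply/rowP => -[].
pose z' : 'rV[R]_n := (\row_j z ord0 (lift ord0 j))%R.
pose T (x : measurableTypeR R * 'rV[R]_n) : measurableTypeR R * 'rV[R]_n :=
  ((x.1 + z ord0 ord0)%R, (x.2 + z')%R).
have mT : measurable_fun [set: measurableTypeR R * 'rV[R]_n] T.
  apply/measurable_fun_pairP; split.
    by apply: measurable_funD => //; exact: measurable_fst.
  exact: (measurableT_comp (measurable_rV_translate z')).
rewrite /= /lebesgue_rV_succ /pushforward -comp_preimage.
rewrite (_ : _ \o _ = @rV_cons R n \o T); last first.
  apply/funext => -[x y]; apply/rowP => i; rewrite !mxE/=.
  by case: unliftP => [j ->|->] /=; rewrite ?mxE.
rewrite comp_preimage.
have mB : measurable (@rV_cons R n @^-1` A).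
  by rewrite -[X in measurable X]setTI; exact: measurable_rV_cons.
apply/esym/(@product_measure_unique _ _ _ _ _ _ _
  (pushforward (@lebesgue_measure R \x borel_lebesgue_rV n) T)) => //.
move=> B C mB' mC.
transitivity ((@lebesgue_measure R \x borel_lebesgue_rV n)
  (((fun x : R => (x + z ord0 ord0)%R) @^-1` B) `*`
   ((fun x : 'rV[R]_n => (x + z')%R) @^-1` C))) => //.
rewrite product_measure1E//.
- by congr (_ * _); [exact: lebesgue_measure_translate|exact: IH].
- rewrite -[X in measurable X]setTI.
  have : measurable_fun [set: measurableTypeR R]
    (fun x : R => (x + z ord0 ord0)%R : measurableTypeR R) by exact: measurable_funD.
  exact.
- by rewrite -[X in measurable X]setTI; exact: measurable_rV_translate.
Qed.

End borel_lebesgue.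

Section lebesgue.
Context {R : realType}.
Variable n : nat.
Local Open Scope ereal_scope.
Implicit Types z : 'rV[R]_n.

Lemma lebesgue_rVE (A : set 'rV[R]_n) : measurable A ->
  lebesgue_rV R n A = borel_lebesgue_rV n A.
Proof. by move=> mA; exact: measurable_mu_extE. Qed.

(** No measurability of [A] is asked: the value is an outer measure, and a translated Borel cover
    has the same total mass. One inequality for all translations suffices, since [- z] undoes
    [z]. *)
Lemma lebesgue_rV_translate z (A : set 'rV[R]_n) :
  lebesgue_rV R n ((fun x : 'rV[R]_n => (x + z)%R) @^-1` A) = lebesgue_rV R n A.
Proof.
have le y (B : set 'rV[R]_n) :
    lebesgue_rV R n ((fun x : 'rV[R]_n => (x + y)%R) @^-1` B) <= lebesgue_rV R n B.
  apply: le_ereal_inf_tmp => _ [F [mF BF] <-].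
  apply: ereal_inf_lbound; exists (fun k => (fun x : 'rV[R]_n => (x + y)%R) @^-1` F k).
    split=> [k|]; last by rewrite -preimage_bigcup; exact: preimage_subset.
    by rewrite -[X in measurable X]setTI; exact: measurable_rV_translate.
  by apply: eq_eseriesr => k _; exact: borel_lebesgue_translate.
apply/eqP; rewrite eq_le le/=.
have := le (- z)%R ((fun x : 'rV[R]_n => (x + z)%R) @^-1` A).
rewrite -comp_preimage (_ : _ \o _ = id) ?preimage_id//.
by apply/funext => x /=; rewrite subrK.
Qed.

(** The Caratheodory criterion for the preimage of [A], tested on [X], is the criterion for [A]
    tested on [X] translated by [z]; invariance must therefore hold for arbitrary sets. *)
Lemma measurable_lebesgue_translate z :
  measurable_fun [set: lebesgue_rV_type R n]
    (fun x : lebesgue_rV_type R n => (x + z)%R : lebesgue_rV_type R n).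
Proof.
move=> _ A mA; rewrite setTI.
pose tA : set 'rV[R]_n := (fun x : 'rV[R]_n => (x + z)%R) @^-1` A.
suff H (X : set 'rV[R]_n) : lebesgue_rV R n X =
  lebesgue_rV R n (X `&` tA) + lebesgue_rV R n (X `&` ~` tA) by exact: H.
have mA' (Y : set 'rV[R]_n) : lebesgue_rV R n Y =
  lebesgue_rV R n (Y `&` A) + lebesgue_rV R n (Y `&` ~` A) := mA Y.
have E (Y : set 'rV[R]_n) : lebesgue_rV R n Y =
    lebesgue_rV R n ((fun x : 'rV[R]_n => (x - z)%R) @^-1` Y).
  by rewrite lebesgue_rV_translate.
have zK (Y : set 'rV[R]_n) : (fun x : 'rV[R]_n => (x - z)%R) @^-1`
    ((fun x : 'rV[R]_n => (x + z)%R) @^-1` Y) = Y.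
  by apply/seteqP; split => x /=; rewrite subrK.
rewrite (E X) (E (X `&` tA)) (E (X `&` ~` tA)) !preimage_setI -preimage_setC zK.
exact: mA'.
Qed.

End lebesgue.

(** * Cubes, Euclidean balls and integrals of periodic functions *)

Section cubes.
Context {R : realType}.
Variable n : nat.
Local Open Scope ereal_scope.
Notation L := (lebesgue_rV_type R n).
Notation mu := (lebesgue_rV R n).

(** The covering argument runs on max-norm cubes, whose volume is explicit; a Euclidean ball is only
    compared with the cubes of radii [r / n] and [r]. *)
Definition cube (x : 'rV[R]_n) (r : R) : set L :=
  [set y : 'rV[R]_n | forall i, (`|y ord0 i - x ord0 i| < r)%R].

Lemma cubeE (x : 'rV[R]_n) (r : R) : cube x r = [set y : 'rV[R]_n |
  forall i, `](x ord0 i - r)%R, (x ord0 i + r)%R[%classic (y ord0 i)].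
Proof.
by apply/seteqP; split => y yr i; have := yr i; rewrite /= in_itv/= ltr_distl.
Qed.

Lemma borel_measurable_cube (x : 'rV[R]_n) (r : R) :
  measurable (cube x r : set 'rV[R]_n).
Proof.
rewrite cubeE; apply: (@measurable_box _ _
  (fun i => `](x ord0 i - r)%R, (x ord0 i + r)%R[%classic)) => i.
exact: measurable_itv.
Qed.

Lemma measurable_cube (x : 'rV[R]_n) (r : R) : measurable (cube x r).
Proof. by apply: caratheodory_measurable_mu_ext; exact: borel_measurable_cube. Qed.

Lemma lebesgue_cube (x : 'rV[R]_n) (r : R) : (0 <= r)%R ->
  mu (cube x r) = ((2 * r) ^+ n)%:E.
Proof.
move=> r0; rewrite lebesgue_rVE; last exact: borel_measurable_cube.
rewrite cubeE; apply: (@borel_lebesgue_box _ _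
  (fun i => `](x ord0 i - r)%R, (x ord0 i + r)%R[%classic)) => i.
  exact: measurable_itv.
rewrite lebesgue_measure_itv/= lte_fin -EFinB.
have -> : (x ord0 i + r - (x ord0 i - r) = 2 * r)%R by ring.
case: ifPn => // /negP xr; congr EFin; apply/eqP; rewrite eq_le; apply/andP; split.
  by rewrite mulr_ge0.
rewrite leNgt; apply/negP => r0'; apply: xr; lra.
Qed.

Lemma lebesgue_unit_cube : mu (@unit_cube R n) = 1.
Proof.
have E : @unit_cube R n = [set y : 'rV[R]_n |
    forall i, `[0%R, 1%R[%classic (y ord0 i)].
  by apply/seteqP; split => y yr i; have := yr i; rewrite /= in_itv.
rewrite lebesgue_rVE; last first.
  by rewrite E; apply: (@measurable_box _ _ (fun=> `[0%R, 1%R[%classic)) => i;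
    exact: measurable_itv.
rewrite E (@borel_lebesgue_box _ _ (fun=> `[0%R, 1%R[%classic) 1%R) ?expr1n// => i.
by rewrite lebesgue_measure_itv/= lte_fin ltr01 oppr0 adde0.
Qed.

Lemma measurable_enorm m (f : L -> 'rV[R]_m) :
  (forall j, measurable_fun [set: L] (fun x => f x ord0 j)) ->
  measurable_fun [set: L] (fun x => enorm (f x)).
Proof.
move=> mf; have ms := continuous_measurable_fun (@sqrt_continuous R).
suff : measurable_fun [set: L] (fun x => dotp (f x) (f x)).
  exact: (measurableT_comp ms).
by apply: measurable_sum => j; apply: measurable_funM; exact: mf.
Qed.

Lemma measurable_coord_lebesgue (j : 'I_n) :
  measurable_fun [set: L] (fun x : L => (x : 'rV[R]_n) ord0 j).
Proof.
move=> _ Y mY; apply: caratheodory_measurable_mu_ext.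
exact: (measurable_coord j measurableT mY).
Qed.

Lemma measurable_eball (x : 'rV[R]_n) (r : R) : measurable (eball x r).
Proof.
have : measurable_fun [set: L] (fun y : L => enorm (y - x)%R).
  apply: (@measurable_enorm _ (fun y : L => (y - x)%R)) => j.
  under eq_fun do rewrite mxE.
  by apply: measurable_funD; [exact: measurable_coord_lebesgue|exact: measurable_cst].
move=> /(_ measurableT `]-oo, r[%classic (measurable_itv _)).
by rewrite setTI; congr measurable; apply/seteqP; split => y; rewrite /= in_itv.
Qed.

End cubes.

Section enorm.
Context {R : realType}.
Variable n : nat.
Implicit Type v : 'rV[R]_n.

Lemma enorm_ge0 v : 0 <= enorm v.
Proof. exact: sqrtr_ge0. Qed.

Lemma le_coord_enorm v i : `|v ord0 i| <= enorm v.
Proof.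
rewrite -sqrtr_sqr ler_sqrt; last first.
  by apply: sumr_ge0 => j _; rewrite -expr2 sqr_ge0.
rewrite /dotp (bigD1 i)//= -expr2 lerDl.
by apply: sumr_ge0 => j _; rewrite -expr2 sqr_ge0.
Qed.

Lemma enorm_lt v r : (0 < n)%N -> (forall i, `|v ord0 i| < r / n%:R) -> enorm v < r.
Proof.
move=> n0 vr; have n0' : 0 < n%:R :> R by rewrite ltr0n.
have r0 : 0 < r.
  have := le_lt_trans (normr_ge0 _) (vr (Ordinal n0)).
  by rewrite pmulr_lgt0// invr_gt0.
rewrite -(ger0_norm (ltW r0)) -sqrtr_sqr ltr_sqrt ?exprn_gt0//.
apply: (@lt_le_trans _ _ (\sum_(j < n) (r / n%:R) ^+ 2)); last first.
  rewrite sumr_const card_ord -[leLHS]mulr_natr expr_div_n -mulrA.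
  by rewrite ger_pMr ?exprn_gt0// expr2 invfM -mulrA mulVf ?gt_eqF// mulr1 invf_le1// ler1n.
apply: Num.Theory.ltr_sum.
  by apply/hasP; exists (Ordinal n0) => //; rewrite mem_index_enum.
move=> i _; rewrite -expr2 -[X in X < _]real_normK ?num_real//.
by rewrite ltr_pXn2r// ?nnegrE// (le_trans _ (ltW (vr i))).
Qed.

Lemma eball_sub_cube (x : 'rV[R]_n) r : eball x r `<=` cube x r.
Proof.
move=> y /= yr i; apply: le_lt_trans yr.
by have := le_coord_enorm (y - x) i; rewrite !mxE.
Qed.

Lemma cube_sub_eball (x : 'rV[R]_n) r : (0 < n)%N -> cube x (r / n%:R) `<=` eball x r.
Proof.
by move=> n0 y /= yr; apply: enorm_lt => // i; have := yr i; rewrite !mxE.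
Qed.

End enorm.

Section periodic.
Context {R : realType}.
Variable n : nat.
Local Open Scope ereal_scope.
Notation L := (lebesgue_rV_type R n).
Notation mu := (lebesgue_rV R n).

Lemma ge0_integral_translate (z : 'rV[R]_n) (g : L -> \bar R) :
  measurable_fun [set: L] g -> (forall x, 0 <= g x) ->
  \int[mu]_x g (x + z)%R = \int[mu]_x g x.
Proof.
move=> mg g0; pose T (x : L) : L := (x + z)%R.
have mT : measurable_fun [set: L] T by exact: measurable_lebesgue_translate.
have := @ge0_integral_pushforward _ _ _ _ R T mT mu setT g measurableT mg (fun y _ => g0 y).
rewrite preimage_setT => <-; apply: eq_measure_integral => A mA _.
exact: lebesgue_rV_translate.
Qed.

(** The union of the (2N+1)^n translates of the unit cube by integer vectors with entries between -N
    and N. *)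
Definition box (N : nat) : set L :=
  [set y : 'rV[R]_n | forall i, (- N%:R <= y ord0 i < N%:R + 1)%R].

Lemma measurable_box_lebesgue N : measurable (box N).
Proof.
apply: caratheodory_measurable_mu_ext.
have -> : box N = [set y : 'rV[R]_n |
    forall i, `[(- N%:R)%R, (N%:R + 1)%R[%classic (y ord0 i)].
  by apply/seteqP; split => y yr i; have := yr i; rewrite /= in_itv.
by apply: (@measurable_box _ _ (fun=> `[(- N%:R)%R, (N%:R + 1)%R[%classic)) => i;
  exact: measurable_itv.
Qed.

(** On the box, [g] is dominated by the sum of the integer translates of its restriction to the unit
    cube, and all of these have the same integral. *)
Lemma le_integral_periodic_box N (g : L -> \bar R) :
  torus_periodic g -> measurable_fun [set: L] g -> (forall x, 0 <= g x) ->
  \int[mu]_(x in box N) g x <=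
    ((N.*2.+1) ^ n)%:R%:E * \int[mu]_(x in @unit_cube R n) g x.
Proof.
move=> pg mg g0; set Q := @unit_cube R n.
have mQ : measurable Q by exact: measurable_unit_cube.
(* For [s i] equal to floor(x_i) + N, the shift N - [s i] is -floor(x_i), which brings [x] into the
   unit cube. *)
pose z (s : {ffun 'I_n -> 'I_(N.*2.+1)}) : 'rV[int]_n :=
  (\row_i (N%:Z - (s i)%:Z))%R.
pose gQ := g \_ Q.
have mgQ : measurable_fun [set: L] gQ.
  by apply/(measurable_restrictT _ mQ); exact: measurable_funTS.
have gQ0 x : 0 <= gQ x by rewrite /gQ patchE; case: ifP.
have mgQz (s : {ffun 'I_n -> 'I_(N.*2.+1)}) :
    measurable_fun [set: L] (fun x : L => gQ (x + map_mx intr (z s))%R).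
  exact: (measurableT_comp mgQ (measurable_lebesgue_translate (map_mx intr (z s)))).
rewrite integral_mkcond [in leRHS]integral_mkcond -/gQ.
apply: (@le_trans _ _ (\int[mu]_x
    \sum_(s : {ffun 'I_n -> 'I_(N.*2.+1)}) gQ (x + map_mx intr (z s))%R)); last first.
  rewrite ge0_integral_sum//.
  under eq_bigr do rewrite ge0_integral_translate//.
  by rewrite sumr_const card_ffun !card_ord mule_natl.
apply: ge0_le_integral; first exact: measurableT.
- by move=> x _; rewrite patchE; case: ifP.
- apply/(measurable_restrictT _ (measurable_box_lebesgue N)); exact: measurable_funTS.
- exact: emeasurable_sum.
move=> x _; rewrite patchE; case: ifPn => [|_]; last first.
  by apply: sume_ge0 => s _; exact: gQ0.
rewrite inE => xN.
have fl i : (0 <= Num.floor (x ord0 i) + N%:Z)%R /\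
    (Num.floor (x ord0 i) + N%:Z < (N.*2.+1)%:Z)%R.
  have /andP[x1 x2] := xN i; split.
    by rewrite -lerBlDr sub0r floor_ge_int rmorphN.
  rewrite -ltrBrDr -addnn -addSn PoszD addrK floor_lt_int.
  by move: x2; rewrite natr1.
have absN i : (absz (Num.floor (x ord0 i) + N%:Z)%R < N.*2.+1)%N.
  by have [h1 h2] := fl i; rewrite -ltz_nat gez0_abs.
pose s : {ffun 'I_n -> 'I_(N.*2.+1)} := [ffun i => Ordinal (absN i)].
rewrite (bigD1 s)//= -[leLHS]adde0 leeD//; last first.
  by apply: sume_ge0 => t _; exact: gQ0.
rewrite /gQ patchE ifT; first by rewrite pg.
rewrite inE => i; rewrite !mxE ffunE /=.
rewrite gez0_abs; last exact: (fl i).1.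
rewrite opprD addrCA subrr addr0 rmorphN/= subr_ge0 floor_le/=.
by rewrite ltrBlDl (lt_le_trans (floorD1_gt _))// rmorphD.
Qed.

End periodic.

(** * A Vitali covering argument *)

(** Continuity from below along finite unions: a covering estimate proved for finite lists, with a
    bound independent of the list, passes to a countable family. *)
Lemma measure_countable_cover_le d (T : measurableType d) (R : realType)
    (mu : {measure set T -> \bar R}) (I : countType) (C : I -> set T)
    (P : set I) (M : \bar R) :
  (forall i, measurable (C i)) ->
  (forall s : seq I, (forall i, i \in s -> P i) ->
    (mu (\big[setU/set0]_(i <- s) C i) <= M)%E) ->
  measurable (\bigcup_(i in P) C i) /\ (mu (\bigcup_(i in P) C i) <= M)%E.
Proof.
move=> mC muM.
(* The indices in [P] whose code under [pickle] is below [N]. *)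
pose s N := [seq i <- pmap (@pickle_inv I) (iota 0 N) | `[< P i >]].
pose F N := \big[setU/set0]_(i <- s N) C i.
have sE N i : i \in s N = `[< P i >] && (pickle i < N)%N.
  rewrite mem_filter; congr (_ && _); rewrite mem_pmap; apply/mapP/idP.
    move=> [k]; rewrite mem_iota/= add0n => kN /esym kE.
    by have := @pickle_invK I k; rewrite kE /= => ->.
  by move=> iN; exists (pickle i); rewrite ?pickleK_inv// mem_iota add0n.
have mF N : measurable (F N) by exact: bigsetU_measurable.
have FE : \bigcup_(i in P) C i = \bigcup_N F N.
  apply/seteqP; split => [x [i Pi Cix]|x [N _]].
    exists (pickle i).+1 => //; rewrite /F -bigcup_seq; exists i => //=.
    by rewrite sE ltnS leqnn andbT; apply/asboolP.
  rewrite /F -bigcup_seq => -[i /=]; rewrite sE => /andP[/asboolP Pi _] Cix.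
  by exists i.
have mFF : measurable (\bigcup_N F N) by exact: bigcupT_measurable.
rewrite FE; split => //.
have ndF : {homo F : a b / (a <= b)%N >-> (a <= b)%O}.
  move=> a b ab; apply/subsetPset; rewrite /F -!bigcup_seq => x [i /=].
  rewrite sE => /andP[Pi ia] Cix; exists i => //=.
  by rewrite sE Pi (leq_trans ia).
have /cvg_lim <- // := nondecreasing_cvg_mu (mu := mu) mF mFF ndF.
apply: lime_le.
  by apply: ereal_nondecreasing_is_cvgn => a b ab /=;
    apply: le_measure; rewrite ?inE//; apply/subsetPset/ndF.
apply: nearW => N /=; apply: muM => i; rewrite sE => /andP[+ _].
by move/asboolP.
Qed.

Section vitali.
Context {R : realType}.
Variable n : nat.
Local Open Scope ereal_scope.
Notation L := (lebesgue_rV_type R n).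
Notation mu := (lebesgue_rV R n).

Lemma cube_triple (x y : 'rV[R]_n) (r s : R) : (r <= s)%R ->
  cube x r `&` cube y s !=set0 -> cube x r `<=` cube y (3 * s).
Proof.
move=> rs [z [zx zy]] w wx i.
have -> : (w ord0 i - y ord0 i = (w ord0 i - x ord0 i) -
  (z ord0 i - x ord0 i) + (z ord0 i - y ord0 i))%R by ring.
apply: le_lt_trans (ler_normD _ _) _.
apply: le_lt_trans (lerD (ler_normB _ _) (lexx _)) _.
have := wx i; have := zx i; have := zy i; lra.
Qed.

(* Greedy selection: the cubes meeting a cube of maximal radius are contained
   in its triple, and the remaining cubes are disjoint from it. *)
Lemma vitali_seq (I : choiceType) (x : I -> 'rV[R]_n) (r : I -> R) (K : R)
    (g : L -> \bar R) (s : seq I) :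
  (0 <= K)%R -> measurable_fun [set: L] g -> (forall y, 0 <= g y) ->
  (forall i, i \in s -> (0 < r i)%R /\
     mu (cube (x i) (r i)) <= K%:E * \int[mu]_(y in cube (x i) (r i)) g y) ->
  mu (\big[setU/set0]_(i <- s) cube (x i) (r i)) <=
  (3 ^+ n * K)%:E * \int[mu]_(y in \big[setU/set0]_(i <- s) cube (x i) (r i)) g y.
Proof.
move=> K0 mg g0.
have [N] := ubnP (size s); elim: N s => // N IH [|i0 s0].
  by rewrite !big_nil measure0 integral_set0 mule0.
move=> sN sK; set s := i0 :: s0 in sN sK *.
have [b bs bmax] : exists2 b, b \in s & forall i, i \in s -> (r i <= r b)%R.
  pose b := [arg max_(j >
    (Ordinal (ltn0Sn (size s0) : 0 < size s)%N)) r (tnth (in_tuple s) j)]%O.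
  exists (tnth (in_tuple s) b); first exact: mem_tnth.
  move=> i /(tnthP (in_tuple s))[j ->].
  by rewrite /b; case: arg_maxP => //= k _; exact.
pose Q i := cube (x i) (r i).
have mQ i : measurable (Q i) by exact: measurable_cube.
pose s' := [seq i <- s | `[< Q i `&` Q b = set0 >]].
have [rb0 Kb] := sK _ bs.
have xb : Q b (x b) by move=> i; rewrite subrr normr0.
(* A positive radius puts the centre in [Q b], so [b] meets itself and is filtered out; the list
   gets strictly shorter. *)
have s's : (size s' < size s)%N.
  rewrite size_filter ltn_neqAle count_size andbT -all_count.
  apply/allPn; exists b => //; apply/negP => /asboolP; rewrite setIid.
  by move/seteqP => [/(_ _ xb)].
have s'sub i : i \in s' -> i \in s by rewrite mem_filter => /andP[].
set U := \big[setU/set0]_(i <- s) _; pose U' := \big[setU/set0]_(i <- s') Q i.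
have mU : measurable U by apply: bigsetU_measurable => i _; exact: mQ.
have mU' : measurable U' by apply: bigsetU_measurable => i _; exact: mQ.
have U'b : [disjoint Q b & U'].
  apply/disj_setPS => y [Qby]; rewrite /U' -bigcup_seq => -[i /=].
  rewrite mem_filter => /andP[/asboolP ib _] Qiy.
  by have : (Q i `&` Q b) y by []; rewrite ib.
have UU' : U `<=` cube (x b) (3 * r b) `|` U'.
  move=> y; rewrite /U -bigcup_seq => -[i /= si Qiy].
  have [ib|ib] := pselect (Q i `&` Q b = set0).
    right; rewrite /U' -bigcup_seq; exists i => //=.
    by rewrite mem_filter si andbT; apply/asboolP.
  left; apply: (cube_triple (bmax _ si)) Qiy.
  by apply/set0P/eqP.
have mb3 : measurable (cube (x b) (3 * r b)) by exact: measurable_cube.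
have H1 : mu U <= mu (cube (x b) (3 * r b)) + mu U'.
  apply: (@le_trans _ _ (mu (cube (x b) (3 * r b) `|` U'))).
    by apply: le_measure; rewrite ?inE//; exact: measurableU.
  exact: measureU2.
have H2 : mu (cube (x b) (3 * r b)) <= (3 ^+ n * K)%:E * \int[mu]_(y in Q b) g y.
  rewrite EFinM -muleA; apply: (@le_trans _ _ ((3 ^+ n)%:E * mu (Q b))).
    rewrite (lebesgue_cube _ (ltW rb0)) lebesgue_cube; last by rewrite mulr_ge0// ltW.
    by rewrite -EFinM lee_fin -exprMn mulrCA.
  by apply: lee_wpmul2l => //; rewrite lee_fin exprn_ge0.
have H3 : mu U' <= (3 ^+ n * K)%:E * \int[mu]_(y in U') g y.
  apply: IH => [|i /s'sub /sK//]; move: sN; rewrite ltnS; exact: leq_trans.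
apply: (le_trans H1); apply: (le_trans (leeD H2 H3)).
rewrite -ge0_muleDr; try by apply: integral_ge0.
have K30 : (0 <= 3 ^+ n * K)%R by rewrite mulr_ge0// exprn_ge0.
(* Since [Q b] and [U'] are disjoint, the two integrals add up without counting any mass twice. *)
rewrite -ge0_integral_setU//; last exact: measurable_funTS.
apply: lee_wpmul2l; first by rewrite lee_fin.
apply: ge0_subset_integral => //; [exact: measurableU|exact: measurable_funTS|].
move=> y [Qby|]; first by rewrite /U -bigcup_seq; exists b.
rewrite /U' /U -!bigcup_seq => -[i /= /s'sub si Qiy].
by exists i.
Qed.

End vitali.

(** * Weak-type estimate for the maximal function *)

Section weak_type.
Context {R : realType}.
Variables (n m : nat).
Hypothesis n_gt0 : (0 < n)%N.
Local Open Scope ereal_scope.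
Notation L := (lebesgue_rV_type R n).
Notation mu := (lebesgue_rV R n).
Notation Q := (@unit_cube R n).

Lemma lebesgue_eball (x : 'rV[R]_n) (r : R) : (0 < r)%R ->
  exists v : R, [/\ (0 < v)%R, mu (eball x r) = v%:E &
    ((2 * (r / n%:R)) ^+ n <= v)%R].
Proof.
move=> r0; have n0 : (0 < n%:R :> R)%R by rewrite ltr0n.
have mB : measurable (eball x r) by exact: measurable_eball.
have lo : ((2 * (r / n%:R)) ^+ n)%:E <= mu (eball x r).
  rewrite -(lebesgue_cube x); last by rewrite divr_ge0// ltW.
  apply: le_measure; rewrite ?inE//; last exact: cube_sub_eball.
  exact: measurable_cube.
have hi : mu (eball x r) <= ((2 * r) ^+ n)%:E.
  rewrite -(lebesgue_cube x) ?(ltW r0)//.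
  apply: le_measure; rewrite ?inE//; last exact: eball_sub_cube.
  exact: measurable_cube.
have fin : mu (eball x r) \is a fin_num.
  by rewrite ge0_fin_numE// (le_lt_trans hi)// ltry.
exists (fine (mu (eball x r))); split; [|by rewrite fineK|by rewrite -lee_fin fineK].
rewrite -lte_fin fineK// (lt_le_trans _ lo)// lte_fin exprn_gt0// mulr_gt0//.
exact: divr_gt0.
Qed.

(** Enlarging to rational data at most doubles the radius. With the point in the unit cube and [r]
    at most 1, the centre moves by less than 1 and the new radius is at most 2, which leaves the
    cube within [-3, 4)^n. *)
Lemma rational_cube (x : 'rV[R]_n) (r : R) : (0 < r)%R -> (r <= 1)%R ->
  (forall i, (0 <= x ord0 i < 1)%R) ->
  exists (q : 'rV[rat]_n) (a : rat), let C := cube (map_mx ratr q) (ratr a) in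
  [/\ (0 < ratr a :> R)%R, (ratr a <= 2 * r :> R)%R, C x, cube x r `<=` C &
    C `<=` box 3].
Proof.
move=> r0 r1 x01.
have r2 : (r < 2 * r)%R by lra.
have [a] := rat_in_itvoo r2.
rewrite in_itv/= => /andP[ra ar].
(* The bound [ratr a - r] keeps the old cube inside the new one; the bound [r] keeps the new one
   inside the box. *)
pose d : R := Num.min (ratr a - r)%R r.
have d0 : (0 < d)%R by rewrite lt_min r0 subr_gt0 ra.
have ex i : exists q : rat, (`|ratr q - x ord0 i| < d)%R.
  have xd : (x ord0 i - d < x ord0 i + d)%R by lra.
  have [q] := rat_in_itvoo xd.
  by rewrite in_itv/= => qi; exists q; rewrite ltr_distl.
have [q qP] := choice ex.
have da : (d <= ratr a - r)%R by rewrite ge_min lexx.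
have dr : (d <= r)%R by rewrite ge_min lexx orbT.
have xC : cube x r `<=` cube (map_mx ratr (\row_i q i)) (ratr a).
  move=> y yr i; rewrite !mxE.
  have := qP i; have := yr i; rewrite !ltr_distl => /andP[? ?] /andP[? ?].
  by apply/andP; split; lra.
exists (\row_i q i)%R, a; split => //.
- lra.
- by apply: ltW; lra.
- by apply: xC => i; rewrite subrr normr0.
- move=> y yC i; have := yC i; have := qP i; have /andP[? ?] := x01 i.
  rewrite !mxE !ltr_distl => /andP[? ?] /andP[? ?].
  by apply/andP; split; lra.
Qed.

(** Values above the threshold are kept at full height, not reduced by [t], as in the integral of
    |u| over {|u| > t}. *)
Definition exceed (t w : R) : R := (w * (t < w)%R%:R)%R.

Lemma measurable_exceed t : measurable_fun [set: R] (exceed t).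
Proof.
apply: measurable_funM => //.
rewrite (_ : (fun w => _) = \1_(`]t, +oo[%classic : set R)).
  exact: measurable_indic.
apply/funext => w; rewrite indicE; congr (_%:R); congr nat_of_bool.
by apply/idP/idP => [tw|]; rewrite ?inE/= ?in_itv/= ?andbT.
Qed.

Lemma exceed_ge0 t w : (0 <= w)%R -> (0 <= exceed t w)%R.
Proof. by move=> w0; rewrite mulr_ge0. Qed.

Lemma le_exceed t w : (0 <= t)%R -> (w <= t + exceed t w)%R.
Proof.
by rewrite /exceed; case: ltP => tw t0; rewrite ?mulr1 ?mulr0 ?addr0// lerDr.
Qed.

(** Where the maximal function reaches [l], some ball has mean of |u| above l/2. Dropping the values
    up to l/4 leaves a mean of at least l/4 on that ball, which is then enlarged to a rational cube.
    [F] is the union of all rational cubes carrying enough of this mass. *)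
Lemma maximal_weak_type (u : 'rV[R]_n -> 'rV[R]_m) :
  torus_periodic u -> lebesgue_measurable u ->
  \int[mu]_(x in Q) (enorm (u x))%:E < +oo ->
  exists2 l0 : R, (0 < l0)%R & forall l : R, (l0 <= l)%R ->
  exists F : set L, [/\ measurable F,
    forall x, Q x -> l%:E <= maximal_function u x -> F x &
    l%:E * mu F <= (4 * (42 * n%:R) ^+ n)%:E *
      \int[mu]_(x in Q) (exceed (l / 4) (enorm (u x)))%:E].
Proof.
move=> pu mu_ uoo; have n0 : (0 < n%:R :> R)%R by rewrite ltr0n.
have mw : measurable_fun [set: L] (fun x => enorm (u x)) by exact: measurable_enorm.
have mew : measurable_fun [set: L] (fun x => (enorm (u x))%:E) by exact/measurable_EFinP.
set A := \int[mu]_(x in Q) _ in uoo.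
have A0 : 0 <= A by apply: integral_ge0 => x _; rewrite lee_fin enorm_ge0.
have AE : A = (fine A)%:E by rewrite fineK// ge0_fin_numE.
have a0 : (0 <= fine A)%R by rewrite fine_ge0.
(* A ball of radius r > 1 lies in a box with 2N+1 <= 2r+3 <= 5r cells per direction and has volume
   at least (2r/n)^n. Its mean is thus at most (5n)^n [A], below l/2 for [l] beyond this value. *)
exists (2 * (5 * n%:R) ^+ n * fine A + 1)%R.
  by rewrite ltr_wpDl// !mulr_ge0// exprn_ge0// mulr_ge0// ltW.
move=> l l0l.
have l0 : (0 < l)%R.
  by apply: lt_le_trans l0l; rewrite ltr_wpDl// !mulr_ge0// exprn_ge0// mulr_ge0// ltW.
pose g (x : L) : \bar R := (exceed (l / 4) (enorm (u x)))%:E.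
have g0 x : 0 <= g x by rewrite lee_fin exceed_ge0// enorm_ge0.
have mg : measurable_fun [set: L] g.
  apply/measurable_EFinP; exact: (measurableT_comp (measurable_exceed _)).
have pg : torus_periodic g by move=> x z; rewrite /g pu.
have pw : torus_periodic (fun x : L => (enorm (u x))%:E : \bar R) by move=> x z; rewrite pu.
(* The rational cube has side at most 4r and the ball volume at least (2r/n)^n, a ratio of (2n)^n;
   the factor 4/l comes from the mean l/4. *)
pose K : R := (4 * (2 * n%:R) ^+ n / l)%R.
have K0 : (0 <= K)%R by rewrite divr_ge0 ?mulr_ge0 ?exprn_ge0 ?mulr_ge0 ?ltW.
pose C (t : 'rV[rat]_n * rat) : set L := cube (map_mx ratr t.1) (ratr t.2).
pose P : set ('rV[rat]_n * rat) := [set t | [/\ (0 < ratr t.2 :> R)%R,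
  C t `<=` box 3 & mu (C t) <= K%:E * \int[mu]_(y in C t) g y]].
have mC t : measurable (C t) by exact: measurable_cube.
have mB3 : measurable (box 3 : set L) by exact: measurable_box_lebesgue.
pose M := (3 ^+ n * K)%:E * (7 ^+ n)%:E * \int[mu]_(x in Q) g x.
have [s sP|mF muF] := @measure_countable_cover_le _ _ R mu _ C P M mC.
  apply: (le_trans (@vitali_seq _ _ _ (fun t : 'rV[rat]_n * rat => map_mx ratr t.1)
    (fun t => ratr t.2) K g s K0 mg g0 _)) => [t /sP[]//|].
  rewrite /M -muleA; apply: lee_wpmul2l; first by rewrite lee_fin mulr_ge0// exprn_ge0.
  apply: (@le_trans _ _ (\int[mu]_(y in box 3) g y)); last first.
    apply: (le_trans (le_integral_periodic_box 3 pg mg g0)).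
    by rewrite natrX.
  apply: (ge0_subset_integral _ _ mB3 (measurable_funTS mg)).
  - by apply: bigsetU_measurable => t _; exact: mC.
  - by move=> y _; exact: g0.
  - by rewrite -bigcup_seq => y [t /= /sP[_ + _]]; exact.
exists (\bigcup_(t in P) C t); split => //; last first.
  apply: (@le_trans _ _ (l%:E * M)); first by apply: lee_wpmul2l => //; rewrite lee_fin ltW.
  rewrite /M !muleA -!EFinM le_eqVlt; apply/orP; left; apply/eqP; congr (_%:E * _).
  (* The factor 3 is Vitali's tripling, 2 comes from [K], and 7 is the number of cells of [box 3] in
     each direction. *)
  rewrite /K (_ : 42 = 3 * (2 * 7))%R; last by ring.
  by rewrite !exprMn; field; rewrite gt_eqF.
move=> x Qx lx.
(* The supremum need not be attained; a lower level yields an actual ball. *)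
have : (l / 2)%:E < maximal_function u x.
  by apply: lt_le_trans lx; rewrite lte_fin; lra.
move=> /ereal_sup_gt[_ /= [r r0 <-]].
have [v [v0 vE lov]] := lebesgue_eball x r0.
rewrite vE inver gt_eqF// lte_pdivlMl// -EFinM => /ltW vu.
have mE : measurable (eball x r) by exact: measurable_eball.
have [r1|r1] := leP r 1%R; last first.
  exfalso.
  pose N := (Num.truncn r).+1.
  have /andP[Nr rN] := truncn_itv (ltW r0).
  rewrite -/N in rN.
  have {}Nr : (N%:R <= r + 1)%R by rewrite -natr1 lerD2r.
  have xN : eball x r `<=` box N.
    move=> y /eball_sub_cube yr i; have := yr i; have /andP[x0 x1] := Qx i.
    rewrite ltr_distl => /andP[h1 h2].
    apply/andP; split.
      by rewrite lerNl; apply: ltW; move: h1 rN; clear -x0; lra.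
    by move: h2 rN x1; clear; lra.
  have : (v * (l / 2))%:E <= (((5 * r) ^+ n)%R)%:E * A.
    apply: (le_trans vu).
    apply: (@le_trans _ _ (\int[mu]_(y in box N) (enorm (u y))%:E)).
      apply: (ge0_subset_integral _ mE (measurable_box_lebesgue N)
        (measurable_funTS mew)) => //.
      by move=> y _; rewrite lee_fin enorm_ge0.
    apply: (le_trans (le_integral_periodic_box N pw mew _)).
      by move=> y; rewrite lee_fin enorm_ge0.
    apply: lee_wpmul2r => //; rewrite lee_fin natrX ler_pXn2r// ?nnegrE ?mulr_ge0 ?(ltW r0)//.
    by rewrite -natr1 -muln2 natrM; clear -Nr r1; lra.
  rewrite AE -EFinM lee_fin leNgt => /negP; apply.
  apply: (@lt_le_trans _ _ ((2 * (r / n%:R)) ^+ n * (l / 2))%R); last first.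
    by rewrite ler_pM2r// divr_gt0.
  apply: (@lt_le_trans _ _ ((2 * (r / n%:R)) ^+ n * ((5 * n%:R) ^+ n * fine A + 2^-1))%R);
    last first.
    apply: ler_wpM2l; last by clear -n m l0l; lra.
    by rewrite exprn_ge0// mulr_ge0// divr_ge0// ltW.
  rewrite mulrDr [X in (_ < X + _)%R]mulrA -exprMn ltr_pwDr//.
    by rewrite mulr_gt0// exprn_gt0// mulr_gt0// divr_gt0.
  rewrite ler_wpM2r// lerXn2r ?nnegrE ?mulr_ge0 ?divr_ge0 ?(ltW r0) ?(ltW n0)//.
  rewrite (_ : 2 * (r / n%:R) * (5 * n%:R) = 10 * r)%R; first by clear -n m r0; lra.
  by field; rewrite gt_eqF.
have [q [a]] := rational_cube r0 r1 Qx.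
set D := cube _ _; move=> [a0' ar Dx rD DB].
exists (q, a) => //; split => //=.
have Gl : (v * (l / 4))%:E <= \int[mu]_(y in eball x r) g y.
  have : (v * (l / 2))%:E <= (l / 4 * v)%:E + \int[mu]_(y in eball x r) g y.
    apply: (le_trans vu).
    rewrite EFinM -vE -integral_cst// -ge0_integralD//.
    - apply: ge0_le_integral; first exact: mE.
      + by move=> y _; rewrite lee_fin enorm_ge0.
      + exact: measurable_funTS.
      + by apply: measurable_funTS; apply: emeasurable_funD.
      + move=> y _; rewrite /g -EFinD lee_fin; apply: le_exceed.
        by rewrite divr_ge0// ltW.
    - by move=> y _; rewrite lee_fin divr_ge0// ltW.
    - exact: measurable_funTS.
  rewrite -leeBlDl// -EFinB (_ : _ - _ = v * (l / 4))%R//.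
  by field.
rewrite lebesgue_cube; last exact: ltW.
apply: (@le_trans _ _ (K%:E * (v * (l / 4))%:E)); last first.
  apply: lee_wpmul2l; first by rewrite lee_fin.
  apply: (le_trans Gl).
  apply: (ge0_subset_integral _ mE (measurable_cube _ _) (measurable_funTS mg)).
    by move=> y _; exact: g0.
  by move=> y /eball_sub_cube /rD.
rewrite -EFinM lee_fin.
apply: (@le_trans _ _ (K * ((2 * (r / n%:R)) ^+ n * (l / 4)))%R); last first.
  by apply: ler_wpM2l => //; apply: ler_wpM2r => //; rewrite divr_ge0// ltW.
rewrite /K [leRHS](_ : _ = (2 * n%:R * (2 * (r / n%:R))) ^+ n)%R; last first.
  rewrite [in RHS]exprMn; set X := ((2 * n%:R) ^+ n)%R; set Y := ((2 * (r / _)) ^+ n)%R.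
  by field; rewrite gt_eqF.
have -> : (2 * n%:R * (2 * (r / n%:R)) = 4 * r)%R by field; rewrite gt_eqF.
rewrite /= lerXn2r ?nnegrE//.
- by apply: mulr_ge0 => //; exact: ltW.
- by apply: mulr_ge0 => //; exact: ltW.
- by clear -n m ar; lra.
Qed.

End weak_type.

(** * Self-improvement from dyadic level sets *)

Section dyadic.
Context {R : realType}.
Variables (e : R) (t0 : R) (s : nat).
Hypotheses (e1 : 1 <= e) (t00 : 0 < t0).

Definition dyadic (j : nat) : R := 2 ^+ j * t0.

Lemma dyadic_gt0 j : 0 < dyadic j.
Proof. by rewrite mulr_gt0// exprn_gt0. Qed.

Lemma le_dyadic i j : (i <= j)%N -> dyadic i <= dyadic j.
Proof. by move=> ij; rewrite ler_pM2r// ler_eXn2l// ltr1n. Qed.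

Lemma dyadicD i j : dyadic (i + j) = 2 ^+ i * dyadic j.
Proof. by rewrite /dyadic exprD mulrA. Qed.

(* A dyadic substitute for the truncated power [(w / (2 ^ s * t0)) `^ eps],
   where [e = 2 `^ eps]. *)
Definition stair (J : nat) (w : R) : R :=
  1 + (e - 1) * \sum_(j < J) e ^+ j * (2 ^+ s * dyadic j < w)%R%:R.

Let e0 : 0 <= e. Proof. exact: le_trans e1. Qed.

Lemma stairS J w : stair J.+1 w =
  stair J w + (e - 1) * (e ^+ J * (2 ^+ s * dyadic J < w)%R%:R).
Proof. by rewrite /stair big_ord_recr/= mulrDr addrA. Qed.

Lemma le_stairS J w : stair J w <= stair J.+1 w.
Proof.
by rewrite stairS lerDl mulr_ge0 ?subr_ge0// mulr_ge0// exprn_ge0.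
Qed.

Lemma stair_ge1 J w : 1 <= stair J w.
Proof.
by elim: J => [|J IH]; [rewrite /stair big_ord0 mulr0 addr0|exact: le_trans (le_stairS _ _)].
Qed.

Lemma le_stair i j w : (i <= j)%N -> stair i w <= stair j w.
Proof.
elim: j => [|j IH]; first by rewrite leqn0 => /eqP ->.
rewrite leq_eqVlt => /predU1P[->//|]; rewrite ltnS => /IH ij.
exact: le_trans (le_stairS _ _).
Qed.

Lemma stair_le J w : stair J w <= e ^+ J.
Proof.
elim: J => [|J IH]; first by rewrite /stair big_ord0 mulr0 addr0 expr0.
rewrite stairS exprS (_ : e * e ^+ J = e ^+ J + (e - 1) * e ^+ J); last by ring.
rewrite lerD// ler_wpM2l ?subr_ge0//.
by case: ltP => _; rewrite ?mulr1// mulr0 exprn_ge0.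
Qed.

(** Once every step is active, (e - 1) times the sum of the e^j telescopes against the initial 1. *)
Lemma stair_full J w : 2 ^+ s * dyadic J < w -> stair J.+1 w = e ^+ J.+1.
Proof.
elim: J => [|J IH] Jw.
  by rewrite stairS /stair big_ord0 Jw mulr1 expr0 expr1; ring.
rewrite stairS IH ?Jw; last first.
  by apply: le_lt_trans Jw; rewrite ler_pM2l ?exprn_gt0// le_dyadic.
by rewrite mulr1 [in RHS]exprS; ring.
Qed.

(** The stair lags [s] levels behind [dyadic], which costs e^s. For j < s the stair has not yet
    risen, but its initial value 1 is enough. *)
Lemma expr_le_stair J j w : (j < J)%N -> dyadic j < w -> e ^+ j <= e ^+ s * stair J w.
Proof.
move=> jJ jw; have [js|sj] := ltnP j s.
  rewrite -[leLHS]mulr1 ler_pM ?stair_ge1 ?exprn_ge0//.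
  by rewrite ler_weXn2l// ltnW.
have jE : 2 ^+ s * dyadic (j - s) < w by rewrite -dyadicD subnKC.
have sE := stair_full jE.
rewrite -[in leLHS](subnKC sj) exprD ler_wpM2l ?exprn_ge0//.
apply: (@le_trans _ _ (stair (j - s).+1 w)); last first.
  by apply: le_stair; apply: leq_ltn_trans jJ; exact: leq_subr.
by rewrite sE ler_weXn2l.
Qed.

(** A geometric sum of ratio 2^q > 1 is controlled by its last term, whose level lies below [w]. *)
Lemma geometric_dyadic J w q : 0 < q ->
  \sum_(j < J) dyadic j `^ q * (dyadic j < w)%R%:R <=
  2 `^ q / (2 `^ q - 1) * w `^ q.
Proof.
move=> q0; set b := 2 `^ q.
have b1 : 0 < b - 1.
  rewrite subr_gt0 -(powRr0 (2 : R)) /b /powR (gt_eqF (_ : 0 < 2))//.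
  by rewrite ltr_expR mul0r mulr_gt0// ln_gt0// ltr1n.
have b0 : 0 < b by rewrite powR_gt0.
set B := b / (b - 1).
have B0 : 0 <= B by rewrite divr_ge0// ltW.
have dS j : dyadic j.+1 `^ q = b * dyadic j `^ q.
  by rewrite /dyadic exprS -mulrA powRM// ltW// dyadic_gt0.
have full i : \sum_(j < i.+1) dyadic j `^ q <= B * dyadic i `^ q.
  elim: i => [|i IH].
    rewrite big_ord_recl big_ord0 addr0 ler_peMl ?powR_ge0//.
    by rewrite ler_pdivlMr// mul1r gerBl.
  rewrite big_ord_recr/= (le_trans (lerD IH (lexx _)))// dS.
  rewrite le_eqVlt; apply/orP; left; apply/eqP.
  by rewrite /B; field; rewrite gt_eqF.
elim: J => [|J IH]; first by rewrite big_ord0 mulr_ge0// powR_ge0.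
have [Jw|wJ] := ltP (dyadic J) w; last first.
  by rewrite big_ord_recr/= ltNge wJ/= mulr0 addr0.
apply: (@le_trans _ _ (\sum_(j < J.+1) dyadic j `^ q)).
  apply: ler_sum => j _; rewrite -[leRHS]mulr1 ler_wpM2l ?powR_ge0//.
  by case: (_ < _).
have w0 : 0 <= w by apply: le_trans (ltW Jw); exact/ltW/dyadic_gt0.
apply: (le_trans (full J)); rewrite ler_wpM2l//.
by apply: ge0_ler_powR; rewrite ?nnegrE ?(ltW q0) ?(ltW Jw) ?(ltW (dyadic_gt0 _)).
Qed.

(** Between two consecutive thresholds the stair already has the height that the power reaches, up
    to the scale factor, at the upper one. *)
Lemma le_stair_powR J w (eps : R) : 0 <= eps -> e = 2 `^ eps -> 0 <= w ->
  w <= 2 ^+ s * dyadic J -> w `^ eps <= (2 ^+ s * t0) `^ eps * stair J w.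
Proof.
move=> eps0 eE w0.
have dE j : (2 ^+ s * dyadic j) `^ eps = (2 ^+ s * t0) `^ eps * e ^+ j.
  have c0 : 0 <= 2 ^+ s * t0 by rewrite mulr_ge0 ?exprn_ge0// ltW.
  rewrite /dyadic mulrCA (powRM _ _ c0) ?exprn_ge0// mulrC; congr (_ * _).
  by rewrite -powR_mulrn// eE -powRrM mulrC powRrM powR_mulrn// powR_ge0.
elim: J => [|J IH] wJ.
  apply: (@le_trans _ _ ((2 ^+ s * dyadic 0) `^ eps)).
    by rewrite ge0_ler_powR ?nnegrE// mulr_ge0 ?exprn_ge0// ltW// dyadic_gt0.
  by rewrite dE expr0 ler_wpM2l ?powR_ge0// stair_ge1.
have [wJ'|Jw] := leP w (2 ^+ s * dyadic J).
  by apply: (le_trans (IH wJ')); rewrite ler_wpM2l ?powR_ge0// le_stairS.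
rewrite (stair_full Jw) -dE ge0_ler_powR ?nnegrE//.
by rewrite mulr_ge0 ?exprn_ge0// ltW// dyadic_gt0.
Qed.

End dyadic.

(** * Integrals of nonnegative real functions *)

Section real_integrals.
Context d (T : measurableType d) (R : realType).
Variables (mu : {measure set T -> \bar R}).
Local Open Scope ereal_scope.
Implicit Types f g : T -> R.

Lemma ge0_le_integral_real f g : (forall x, 0 <= f x)%R ->
  measurable_fun [set: T] f -> measurable_fun [set: T] g ->
  (forall x, f x <= g x)%R ->
  \int[mu]_x (f x)%:E <= \int[mu]_x (g x)%:E.
Proof.
move=> f0 mf mg fg; apply: ge0_le_integral => //.
- by move=> x _; rewrite lee_fin.
- exact/measurable_EFinP.
- exact/measurable_EFinP.
- by move=> x _; rewrite lee_fin.
Qed.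

Lemma ge0_integralZ_real (k : R) f : (0 <= k)%R -> (forall x, 0 <= f x)%R ->
  measurable_fun [set: T] f ->
  \int[mu]_x (k * f x)%:E = k%:E * \int[mu]_x (f x)%:E.
Proof.
move=> k0 f0 mf; under eq_integral do rewrite EFinM.
apply: ge0_integralZl_EFin => //; last exact/measurable_EFinP.
by move=> x _; rewrite lee_fin.
Qed.

Lemma ge0_integralD_real f g : (forall x, 0 <= f x)%R -> (forall x, 0 <= g x)%R ->
  measurable_fun [set: T] f -> measurable_fun [set: T] g ->
  \int[mu]_x (f x + g x)%:E = \int[mu]_x (f x)%:E + \int[mu]_x (g x)%:E.
Proof.
move=> f0 g0 mf mg; under eq_integral do rewrite EFinD.
apply: ge0_integralD => //.
- by move=> x _; rewrite lee_fin.
- exact/measurable_EFinP.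
- by move=> x _; rewrite lee_fin.
- exact/measurable_EFinP.
Qed.

Lemma ge0_integral_sum_real (I : Type) (s : seq I) (f : I -> T -> R) :
  (forall i x, 0 <= f i x)%R -> (forall i, measurable_fun [set: T] (f i)) ->
  \int[mu]_x (\sum_(i <- s) f i x)%R%:E = \sum_(i <- s) \int[mu]_x (f i x)%:E.
Proof.
move=> f0 mf; under eq_integral do rewrite -sumEFin.
apply: ge0_integral_sum => //.
- by move=> i; exact/measurable_EFinP.
- by move=> i x _; rewrite lee_fin.
Qed.

End real_integrals.


(** * Higher integrability from a level-set inequality *)

Section reverse_holder.
Context d (T : measurableType d) (R : realType).
Variables (mu : {measure set T -> \bar R}) (w : T -> R).
Variables (p eps t0 K : R) (s : nat).
Hypotheses (mw : measurable_fun [set: T] w) (w0 : forall x, 0 <= w x).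
Hypotheses (p1 : 1 < p) (eps0 : 0 < eps) (t00 : 0 < t0) (K0 : 0 <= K).
Local Open Scope ereal_scope.

Let e : R := (2 `^ eps)%R.

Let e1 : (1 <= e)%R.
Proof. by rewrite -[leLHS](powRr0 2); apply: ler_powR; rewrite ?ler1n// ltW. Qed.

Let e_ge0 : (0 <= e)%R. Proof. exact: powR_ge0. Qed.

(* Sum the hypothesis over the dyadic levels, weighted by [2 `^ (j * eps)]; for
   small [eps] the right-hand side is absorbed, the truncated sums being finite. *)
Lemma self_improvement :
  \int[mu]_x ((w x `^ p)%:E) < +oo ->
  (forall t : R, (t0 <= t)%R ->
    \int[mu]_x (w x `^ p * (2 ^+ s * t < w x)%R%:R)%:E <=
    (K * t `^ (p - 1))%:E * \int[mu]_x (exceed t (w x))%:E) ->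
  ((e - 1) * (K * (2 `^ (p - 1) / (2 `^ (p - 1) - 1)) * e ^+ s) <= 2^-1)%R ->
  \int[mu]_x ((w x `^ (p + eps))%:E) < +oo.
Proof.
move=> Yoo HK small.
set Y := integral _ _ _ in Yoo.
have q0 : (0 < p - 1)%R by rewrite subr_gt0.
have mwp r : measurable_fun [set: T] (fun x => w x `^ r)%R.
  exact: (measurableT_comp (measurable_powR r)).
have mlt t : measurable_fun [set: T] (fun x => (t < w x)%R%:R : R).
  rewrite (_ : (fun x => _) = \1_(w @^-1` `]t, +oo[%classic)).
    by apply: measurable_indic; rewrite -[X in measurable X]setTI; exact: mw.
  apply/funext => x; rewrite indicE; congr (_%:R); congr nat_of_bool.
  by apply/idP/idP => [tw|]; rewrite ?inE/= ?in_itv/= ?andbT.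
pose D j : R := dyadic t0 j.
have D0 j : (0 < D j)%R by exact: dyadic_gt0.
pose st J x : R := stair e t0 s J (w x).
have mst J : measurable_fun [set: T] (st J).
  apply: measurable_funD => //; apply: measurable_funM => //.
  by apply: measurable_sum => j; apply: measurable_funM.
pose X J := \int[mu]_x (w x `^ p * st J x)%:E.
have wp0 x : (0 <= w x `^ p)%R by exact: powR_ge0.
have st0 J x : (0 <= st J x)%R by rewrite (le_trans ler01)// stair_ge1.
have mwst J : measurable_fun [set: T] (fun x => w x `^ p * st J x)%R.
  by apply: measurable_funM.
have wst0 J x : (0 <= w x `^ p * st J x)%R by rewrite mulr_ge0.
have Xfin J : X J < +oo.
  apply: (@le_lt_trans _ _ ((e ^+ J)%:E * Y)).
    rewrite -ge0_integralZ_real ?exprn_ge0//.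
    apply: ge0_le_integral_real => //; first by apply: measurable_funM.
    by move=> x; rewrite mulrC ler_wpM2r// stair_le.
  by rewrite lte_mul_pinfty// lee_fin exprn_ge0.
pose B : R := (2 `^ (p - 1) / (2 `^ (p - 1) - 1))%R.
pose c j : R := ((e - 1) * e ^+ j)%R.
have c0 j : (0 <= c j)%R by rewrite mulr_ge0 ?subr_ge0// exprn_ge0.
have exm t : measurable_fun [set: T] (fun x => exceed t (w x)).
  exact: (measurableT_comp (measurable_exceed t)).
have ex0 t x : (0 <= exceed t (w x))%R by exact: exceed_ge0.
have X_half J : X J <= Y + 2^-1%:E * X J.
  have mI j : measurable_fun [set: T]
      (fun x => w x `^ p * (2 ^+ s * D j < w x)%R%:R)%R by apply: measurable_funM.
  have wI0 j x : (0 <= w x `^ p * (2 ^+ s * D j < w x)%R%:R)%R by exact: mulr_ge0.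
  (* The initial 1 of the stair contributes [Y]; each step contributes one level-set integral, to
     which [HK] applies. *)
  have XE : X J = Y + \sum_(j < J) (c j)%:E *
      \int[mu]_x (w x `^ p * (2 ^+ s * D j < w x)%R%:R)%:E.
    under eq_bigr => j _.
      rewrite -ge0_integralZ_real//.
      over.
    rewrite -ge0_integral_sum_real; last 2 first.
    - by move=> j x; exact/mulr_ge0/wI0.
    - by move=> j; apply: measurable_funM.
    rewrite -ge0_integralD_real//; last 2 first.
    - by move=> x; apply: sumr_ge0 => j _; exact/mulr_ge0/wI0.
    - by apply: measurable_sum => j; apply: measurable_funM.
    apply: eq_integral => x _; rewrite /st /stair mulrDr mulr1; congr (_ + _)%:E.
    rewrite !mulr_sumr; apply: eq_bigr => j _.
    by rewrite /c; ring.
  rewrite {1}XE leeD2l//.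
  apply: (@le_trans _ _ (\sum_(j < J) (c j * (K * D j `^ (p - 1)))%:E *
      \int[mu]_x (exceed (D j) (w x))%:E)).
    apply: lee_sum => j _; rewrite (EFinM (c j)) -muleA; apply: lee_wpmul2l.
      by rewrite lee_fin.
    by apply: HK; have := le_dyadic t00 (leq0n j); rewrite /dyadic expr0 mul1r.
  have cK0 j : (0 <= c j * (K * D j `^ (p - 1)))%R.
    by apply: mulr_ge0 => //; apply: mulr_ge0 => //; exact: powR_ge0.
  under eq_bigr => j _.
    rewrite -ge0_integralZ_real//.
    over.
  rewrite -ge0_integral_sum_real; last 2 first.
  - by move=> j x; exact: mulr_ge0.
  - by move=> j; apply: measurable_funM.
  rewrite -ge0_integralZ_real//.
  apply: ge0_le_integral_real.
  - by move=> x; apply: sumr_ge0 => j _; exact: mulr_ge0.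
  - by apply: measurable_sum => j; apply: measurable_funM.
  - by apply: measurable_funM.
  move=> x.
  (* Wherever the indicator is nonzero, e^j is bounded by the stair, independently of j; what
     remains is geometric in [D j ^ (p - 1)], and its sum restores the missing power of [w]. *)
  apply: (@le_trans _ _ (\sum_(j < J) ((e - 1) * K * (e ^+ s * st J x) * w x) *
      (D j `^ (p - 1) * (D j < w x)%R%:R))%R).
    apply: ler_sum => j _; rewrite /exceed; have [jw|_] := ltP (D j) (w x).
      rewrite !mulr1 /c [leLHS](_ : _ = e ^+ j * ((e - 1) * K * w x * D j `^ (p - 1)))%R;
        last by ring.
      rewrite [leRHS](_ : _ = (e ^+ s * st J x) * ((e - 1) * K * w x * D j `^ (p - 1)))%R;
        last by ring.
      rewrite ler_wpM2r//; last exact: (@expr_le_stair _ _ _ _ e1 t00 _ _ _ (ltn_ord j) jw).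
      by rewrite !mulr_ge0 ?subr_ge0// powR_ge0.
    by rewrite !mulr0.
  rewrite -mulr_sumr.
  apply: (@le_trans _ _ ((e - 1) * K * (e ^+ s * st J x) * w x * (B * w x `^ (p - 1)))%R).
    rewrite ler_wpM2l ?geometric_dyadic//.
    by rewrite !mulr_ge0 ?subr_ge0// exprn_ge0.
  rewrite -(mulr_powRB1 (w0 x) (lt_trans ltr01 p1)).
  rewrite [leLHS](_ : _ = ((e - 1) * (K * B * e ^+ s)) * (w x * w x `^ (p - 1) * st J x))%R;
    last by ring.
  by rewrite ler_wpM2r// !mulr_ge0// powR_ge0.
have Y0 : 0 <= Y by apply: integral_ge0 => x _; rewrite lee_fin.
have X0 J : 0 <= X J by apply: integral_ge0 => x _; rewrite lee_fin mulr_ge0.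
(* Finiteness of [X J] permits the subtraction of half of it. *)
have X2 J : X J <= 2%:E * Y.
  move: (X_half J) (Xfin J) (X0 J) Y0 Yoo.
  move: (X J) (Y) => [x| |] [y| |]//.
  by rewrite -!EFinM -EFinD !lee_fin => *; lra.
pose c1 : R := ((2 ^+ s * t0) `^ eps)%R.
(* On [F J] the stair dominates the full power [w ^ eps]; these sets exhaust the space, so monotone
   convergence removes the truncation. *)
pose F J := [set x | (w x <= 2 ^+ s * D J)%R].
have mF J : measurable (F J).
  rewrite (_ : F J = w @^-1` `]-oo, (2 ^+ s * D J)%R]%classic).
    by rewrite -[X in measurable X]setTI; exact: mw.
  by apply/seteqP; split => x; rewrite /F /= in_itv.
have ndF : nondecreasing_seq F.
  move=> i j ij; apply/subsetPset => x /le_trans; apply.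
  by rewrite ler_pM2l ?exprn_gt0// le_dyadic.
have FT : \bigcup_J F J = setT.
  apply/seteqP; split => // x _; exists (Num.truncn (w x / t0)).+1 => //.
  rewrite /F /D /dyadic /=; set N := (Num.truncn _).+1.
  have : (w x / t0 < N%:R)%R by exact: truncnS_gt.
  rewrite ltr_pdivrMr// => /ltW /le_trans; apply.
  rewrite mulrA ler_pM2r// -natrX -natrX -natrM ler_nat.
  by rewrite (leq_trans (ltnW (ltn_expl N (isT : 1 < 2)%N)))// leq_pmull// expn_gt0.
have FJ J : \int[mu]_(x in F J) (w x `^ (p + eps))%:E <= c1%:E * (2%:E * Y).
  apply: (@le_trans _ _ (c1%:E * X J)); last first.
    by apply: lee_wpmul2l => //; rewrite lee_fin powR_ge0.
  have c10 : (0 <= c1)%R by exact: powR_ge0.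
  have mc : measurable_fun [set: T] (fun x => (c1 * (w x `^ p * st J x))%:E).
    by apply/measurable_EFinP; apply: measurable_funM.
  rewrite /X -ge0_integralZ_real//.
  apply: (@le_trans _ _ (\int[mu]_(x in F J) (c1 * (w x `^ p * st J x))%:E)).
    apply: ge0_le_integral => //.
    - by move=> x _; rewrite lee_fin powR_ge0.
    - exact/measurable_funTS/measurable_EFinP.
    - exact/measurable_funTS.
    move=> x xJ; rewrite lee_fin powRD; last first.
      by rewrite gt_eqF// addr_gt0// (lt_trans ltr01).
    rewrite mulrCA ler_wpM2l//.
    exact: (le_stair_powR e1 t00 (ltW eps0) erefl (w0 x) xJ).
  apply: ge0_subset_integral => //.
  by move=> x _; rewrite lee_fin mulr_ge0.
apply: (@le_lt_trans _ _ (c1%:E * (2%:E * Y))); last first.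
  by rewrite !lte_mul_pinfty ?lee_fin ?powR_ge0// mule_ge0.
have mf i : measurable_fun (F i) (fun x => (w x `^ (p + eps))%:E).
  exact/measurable_funTS/measurable_EFinP.
have f0 i x : F i x -> 0 <= (w x `^ (p + eps))%:E by rewrite lee_fin powR_ge0.
rewrite -FT -(cvg_lim _ (ge0_nondecreasing_set_cvg_integral (mu := mu) ndF mF mf f0))//.
apply: lime_le; last exact: nearW.
apply: ereal_nondecreasing_is_cvgn.
exact: ge0_nondecreasing_set_nondecreasing_integral.
Qed.

End reverse_holder.

(** * Comparison of energies *)

Section energy_comparison.
Context d (T : measurableType d) (R : realType).
Variable mu : {measure set T -> \bar R}.
Local Open Scope ereal_scope.

Lemma integral_max0 (f : T -> R) : measurable_fun [set: T] f ->
  {ae mu, forall x, (0 <= f x)%R} ->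
  \int[mu]_x (f x)%:E = \int[mu]_x (Num.max (f x) 0)%R%:E.
Proof.
move=> mf f0; apply: ae_eq_integral => //.
- exact/measurable_EFinP.
- by apply/measurable_EFinP; exact: measurable_maxr.
by apply: filterS f0 => x f0 _; rewrite max_l.
Qed.

(** Off [D] the integrals of [f] and [g] are equal and finite, hence cancel. What remains is a
    comparison on [D], where [f] dominates [h] and [g] is at most [M]. *)
Lemma integral_le_off_contact (f g h : T -> R) (D : set T) (M : R) :
  mu [set: T] < +oo -> measurable D ->
  measurable_fun [set: T] f -> measurable_fun [set: T] g ->
  measurable_fun [set: T] h -> (forall x, 0 <= h x)%R -> (0 <= M)%R ->
  {ae mu, forall x, (0 <= g x <= M)%R} -> {ae mu, forall x, (h x <= f x)%R} ->
  {ae mu, forall x, h x != 0%R -> D x} ->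
  (forall x, ~ D x -> f x = g x) ->
  \int[mu]_x (f x)%:E <= \int[mu]_x (g x)%:E ->
  \int[mu]_x (h x)%:E <= M%:E * mu D.
Proof.
move=> muT mD mf mg mh h0 M0 gM hf hD fgD.
have f0 : {ae mu, forall x, (0 <= f x)%R}.
  by apply: filterS hf => x; exact: le_trans.
have g0 : {ae mu, forall x, (0 <= g x)%R} by apply: filterS gM => x /andP[].
rewrite (integral_max0 mf f0) (integral_max0 mg g0).
set F := fun x => (Num.max (f x) 0)%R%:E; set G := fun x => (Num.max (g x) 0)%R%:E.
have mF : measurable_fun [set: T] F by apply/measurable_EFinP; exact: measurable_maxr.
have mG : measurable_fun [set: T] G by apply/measurable_EFinP; exact: measurable_maxr.
have F0 x : 0 <= F x by rewrite lee_fin le_max lexx orbT.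
have G0 x : 0 <= G x by rewrite lee_fin le_max lexx orbT.
have mDC : measurable (~` D) by exact: measurableC.
have split_int (H : T -> \bar R) : measurable_fun [set: T] H -> (forall x, 0 <= H x) ->
    \int[mu]_x H x = \int[mu]_(x in D) H x + \int[mu]_(x in ~` D) H x.
  move=> mH H0; rewrite -ge0_integral_setU ?setUv//.
  exact/disj_setPCl.
have GM (E : set T) : measurable E -> \int[mu]_(x in E) G x <= M%:E * mu E.
  move=> mE; rewrite -integral_cst//; apply: ae_ge0_le_integral => //.
  - exact: measurable_funTS.
  - by apply: filterS gM => x /andP[g0x gMx] _; rewrite lee_fin ge_max gMx.
rewrite (split_int F)// (split_int G)//.
have -> : \int[mu]_(x in ~` D) F x = \int[mu]_(x in ~` D) G x.
  by apply: eq_integral => x; rewrite inE => Dx; rewrite /F fgD.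
have Gfin : \int[mu]_(x in ~` D) G x \is a fin_num.
  rewrite ge0_fin_numE; last exact: integral_ge0.
  apply: (le_lt_trans (GM _ mDC)); rewrite lte_mul_pinfty//.
  by apply: le_lt_trans muT; apply: le_measure; rewrite ?inE.
rewrite leeD2rE// => FG.
apply: le_trans (GM _ mD); apply: le_trans FG.
rewrite [leRHS]integral_mkcond.
apply: ae_ge0_le_integral => //.
- by move=> x _; rewrite lee_fin.
- exact/measurable_EFinP.
- by move=> x _; rewrite patchE; case: ifP.
- by apply/(measurable_restrictT _ mD); exact: measurable_funTS.
apply: filterS2 hf hD => x hfx hDx _; rewrite patchE.
have [hx0|/hDx Dx] := eqVneq (h x) 0%R; first by rewrite hx0; case: ifP.
by rewrite mem_set// lee_fin le_max hfx.
Qed.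

End energy_comparison.

(** * Integration over the torus *)

Section torus.
Context {R : realType}.
Variable n : nat.
Local Open Scope ereal_scope.
Notation L := (lebesgue_rV_type R n).
Notation mu := (lebesgue_rV R n).
Notation P := (torus_measure R n).
Notation Q := (@unit_cube R n).

Lemma torus_measureT : P [set: L] = 1.
Proof. by rewrite /torus_measure /mrestr setTI lebesgue_unit_cube. Qed.

Lemma torus_measure_le (A : set L) : measurable A -> P A <= mu A.
Proof.
move=> mA; have mQ : measurable Q by exact: measurable_unit_cube.
by apply: le_measure; rewrite ?inE//; exact: measurableI.
Qed.

Lemma ae_unit_cube : {ae P, forall x : L, Q x}.
Proof.
have mQ : measurable Q by exact: measurable_unit_cube.
exists (~` Q); split; [exact: measurableC| |by []].
by rewrite /torus_measure /mrestr setICl measure0.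
Qed.

Lemma ge0_integral_torus (f : L -> \bar R) : measurable_fun [set: L] f ->
  (forall x, 0 <= f x) -> \int[P]_x f x = \int[mu]_(x in Q) f x.
Proof.
move=> mf f0; have mQ : measurable Q by exact: measurable_unit_cube.
have mQC : measurable (~` Q) by exact: measurableC.
have PQC : P (~` Q) = 0 by rewrite /torus_measure /mrestr setICl measure0.
rewrite (ge0_negligible_integral mQC measurableT mf (fun x _ => f0 x) PQC).
rewrite setTD setCK; apply: eq_measure_integral => A mA AQ.
by rewrite /torus_measure /mrestr; congr (mu _); apply/setIidPl.
Qed.

Lemma Lp_norm_lty m (u : 'rV[R]_n -> 'rV[R]_m) (p : R) : (p != 0)%R ->
  Lp_norm p%:E u < +oo <-> \int[P]_x (enorm (u x) `^ p)%:E < +oo.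
Proof.
move=> p0; rewrite /Lp_norm unlock /=.
under eq_integral do rewrite ger0_norm ?enorm_ge0//.
by split; [apply: lty_poweRy; rewrite invr_eq0|exact: poweR_lty].
Qed.

End torus.

Lemma integral_torus_cst (R : realType) (n : nat) (r : R) :
  (\int[torus_measure R n]_x r%:E = r%:E)%E.
Proof.
rewrite integral_cst; last exact: measurableT.
by rewrite -[RHS]mule1; congr (_ * _)%E; exact: torus_measureT.
Qed.

(** * The level-set estimate for a minimiser *)

Section minimisers.
Context {R : realType}.
Variables (n m l k : nat).
Hypothesis n_gt0 : (0 < n)%N.
Variables (p C nu c : R) (A : diff_op R n m l k).
Variable f : 'rV[R]_n -> 'rV[R]_m -> R.
Hypothesis p_gt1 : 1 < p.
Hypothesis mf : integrand_measurable f.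
Hypothesis f_growth : {ae torus_measure R n, forall x : lebesgue_rV_type R n,
  forall w : 'rV[R]_m, enorm w `^ p <= f x w /\ f x w <= nu * enorm w `^ p + c}.
Local Open Scope ereal_scope.
Notation L := (lebesgue_rV_type R n).
Notation P := (torus_measure R n).

Let p0 : (0 < p)%R. Proof. exact: lt_trans p_gt1. Qed.

(** Absolute values make the growth bound nondecreasing in |u| whatever the signs of [nu] and
    [c]. *)
Lemma ae_bounded_energy (u : 'rV[R]_n -> 'rV[R]_m) (b : R) :
  {ae P, forall x : L, (enorm (u x) <= b)%R} ->
  {ae P, forall x : L, (0 <= f x (u x) <= `|nu| * b `^ p + `|c|)%R}.
Proof.
move=> ub; apply: filterS2 f_growth ub => x fx ux.
have [h1 h2] := fx (u x).
rewrite (le_trans (powR_ge0 _ _) h1)/=; apply: (le_trans h2).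
apply: lerD; last exact: ler_norm.
apply: (@le_trans _ _ (`|nu| * enorm (u x) `^ p)%R).
  by rewrite ler_wpM2r ?powR_ge0// ler_norm.
rewrite ler_wpM2l// ge0_ler_powR ?nnegrE ?enorm_ge0 ?(ltW p0)//.
exact: le_trans (enorm_ge0 _) ux.
Qed.

(** The zero field is a competitor of finite energy, which rules out the value +oo for [u]. *)
Lemma minimiser_A_free u : minimiser A f p u -> A_free A u.
Proof.
move=> [_ umin]; pose z : 'rV[R]_n -> 'rV[R]_m := (fun=> 0%R).
have z0 x : enorm (z x) = 0%R.
  by rewrite /enorm /dotp big1 ?sqrtr0// => j _; rewrite !mxE mulr0.
have zA : A_free A z.
  move=> phi _ _; rewrite (_ : (fun x => _) = cst 0) ?integral0//.
  by apply/funext => x; rewrite /dotp big1// => j _; rewrite !mxE mul0r.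
have mz : lebesgue_measurable z by move=> j; exact: measurable_cst.
have zp : in_Lp p%:E z.
  split => //; apply/Lp_norm_lty; first by rewrite gt_eqF.
  under eq_integral do rewrite z0 powR0 ?gt_eqF//.
  by rewrite integral0.
have mfz : measurable_fun [set: L] (fun x : L => f x (z x)) by exact: mf.
have fz : {ae P, forall x : L, (0 <= f x (z x) <= `|nu| * 0 `^ p + `|c|)%R}.
  by apply: ae_bounded_energy; apply: aeW => x; rewrite z0.
have := umin _ zp; rewrite /energy (asboolT zA).
case: asboolP => // _; rewrite leye_eq => /eqP zoo.
suff : \int[P]_x (f x (z x))%:E < +oo by rewrite zoo.
rewrite integral_max0//; last by apply: filterS fz => x /andP[].
apply: (@le_lt_trans _ _ (\int[P]_x (`|nu| * 0 `^ p + `|c|)%:E)).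
  apply: ae_ge0_le_integral.
  - exact: measurableT.
  - by move=> x _; rewrite lee_fin le_max lexx orbT.
  - by apply/measurable_EFinP; exact: measurable_maxr.
  - by move=> x _; rewrite lee_fin addr_ge0// mulr_ge0// powR_ge0.
  - exact: measurable_cst.
  - by apply: filterS fz => x /andP[h1 h2] _; rewrite lee_fin ge_max h2;
      rewrite addr_ge0// mulr_ge0// powR_ge0.
by rewrite integral_torus_cst ltry.
Qed.

Lemma integral_enorm_lty (u : 'rV[R]_n -> 'rV[R]_m) : lebesgue_measurable u ->
  \int[P]_x (enorm (u x) `^ p)%:E < +oo -> \int[P]_x (enorm (u x))%:E < +oo.
Proof.
move=> mu up.
have mw : measurable_fun [set: L] (fun x => enorm (u x)) by exact: measurable_enorm.
have mwp : measurable_fun [set: L] (fun x => enorm (u x) `^ p)%R.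
  exact: (measurableT_comp (measurable_powR p)).
apply: (@le_lt_trans _ _ (\int[P]_x (1 + enorm (u x) `^ p)%:E)).
  apply: ge0_le_integral_real.
  - by move=> x; exact: enorm_ge0.
  - exact: mw.
  - by apply: measurable_funD; [exact: measurable_cst|exact: mwp].
  move=> x; have [w1|w1] := leP (enorm (u x)) 1%R.
    by rewrite (le_trans w1)// lerDl powR_ge0.
  by rewrite (le_trans (le1r_powR _ (ltW p_gt1)))// ?lerDr ?ltW.
have w0 (x : L) : (0 <= enorm (u x) `^ p)%R by exact: powR_ge0.
rewrite (ge0_integralD_real _ (fun=> ler01) w0 (measurable_cst _) mwp).
by rewrite integral_torus_cst lte_add_pinfty ?ltry.
Qed.

(** Truncating at 4t turns the weak-type threshold l/4 into [t], and bounds the truncation by 4|C|t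
    <= 2^s t: where |u| exceeds this, the two fields must differ. *)
Lemma level_estimate s u : truncation_property A p C -> minimiser A f p u ->
  (4 * `|C| <= 2 ^+ s)%R ->
  exists2 t0 : R, (0 < t0)%R & forall t : R, (t0 <= t)%R ->
    \int[P]_x (enorm (u x) `^ p * (2 ^+ s * t < enorm (u x))%R%:R)%:E <=
    ((`|nu| * (2 ^+ s) `^ p + 1) * (42 * n%:R) ^+ n * t `^ (p - 1))%:E *
      \int[P]_x (exceed t (enorm (u x)))%:E.
Proof.
move=> TP um Cs; have uA := minimiser_A_free um.
have [[pu mu /Lp_norm_lty up] umin] := um.
have {}up := up (negbT (gt_eqF p0)).
have mw : measurable_fun [set: L] (fun x => enorm (u x)) by exact: measurable_enorm.
have mew : measurable_fun [set: L] (fun x => (enorm (u x))%:E) by exact/measurable_EFinP.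
have [l0 l00 weak] : exists2 l0 : R, (0 < l0)%R & forall l : R, (l0 <= l)%R ->
    exists F : set L, [/\ measurable F,
    forall x, @unit_cube R n x -> l%:E <= maximal_function u x -> F x &
    l%:E * lebesgue_rV R n F <= (4 * (42 * n%:R) ^+ n)%:E *
      \int[lebesgue_rV R n]_(x in @unit_cube R n) (exceed (l / 4) (enorm (u x)))%:E].
  apply: (maximal_weak_type n_gt0 pu mu).
  rewrite -(ge0_integral_torus mew); first exact: integral_enorm_lty.
  by move=> x; rewrite lee_fin enorm_ge0.
(* The term 1 gives t <= t^p, |c| lets t^p absorb the constant [c], and [l0] admits the weak-type
   bound. *)
exists (1 + `|c| + l0)%R; first by rewrite addr_gt0// ltr_wpDr.
move=> t t0t; have t1 : (1 <= t)%R.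
  by apply: le_trans t0t; rewrite -addrA lerDl addr_ge0// ltW.
have t0 : (0 < t)%R by exact: lt_le_trans t1.
have ct : (`|c| <= t)%R by move: t0t l00; lra.
have l0t : (l0 <= 4 * t)%R.
  by have := normr_ge0 c; move: t0t t0; lra.
have [F [mF uF]] := weak _ l0t.
rewrite (_ : 4 * t / 4 = t)%R; last by field.
rewrite -ge0_integral_torus; last 2 first.
- by apply/measurable_EFinP; exact: (measurableT_comp (measurable_exceed t)).
- by move=> x; rewrite lee_fin exceed_ge0// enorm_ge0.
set E := \int[P]_x _ => FE.
have t40 : (0 < 4 * t)%R by rewrite mulr_gt0.
have [v [[pv mv vfin] vA vC uv]] := TP u (4 * t)%R um.1 uA t40.
have vb : {ae P, forall x : L, (enorm (v x) <= 2 ^+ s * t)%R}.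
  move: vC; rewrite /Lp_norm unlock /= torus_measureT lte01 => /ess_supP.
  apply: filterS => x /=; rewrite lee_fin ger0_norm ?enorm_ge0// => /le_trans; apply.
  rewrite mulrCA mulrA ler_wpM2r ?(ltW t0)//; apply: le_trans Cs.
  by rewrite ler_pM2l// ler_norm.
have fv := ae_bounded_energy vb.
have Lv : in_Lp p%:E v.
  split => //; apply/Lp_norm_lty; first by rewrite gt_eqF.
  apply: (@le_lt_trans _ _ (\int[P]_x ((2 ^+ s * t) `^ p)%:E)).
    apply: ae_ge0_le_integral.
    - exact: measurableT.
    - by move=> x _; rewrite lee_fin powR_ge0.
    - apply/measurable_EFinP; apply: (measurableT_comp (measurable_powR p)).
      exact: measurable_enorm.
    - by move=> x _; rewrite lee_fin powR_ge0.
    - exact: measurable_cst.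
    - apply: filterS vb => x vx _; rewrite lee_fin.
      rewrite ge0_ler_powR ?nnegrE ?enorm_ge0 ?(ltW p0)//.
      by rewrite mulr_ge0 ?exprn_ge0// ltW.
  by rewrite integral_torus_cst ltry.
have := umin _ Lv; rewrite /energy !asboolT// => fuv.
pose D : set L := [set x | u x <> v x].
have mD : measurable D.
  rewrite (_ : D = ~` \bigcap_(j in [set: 'I_m])
      ((fun x : L => u x ord0 j - v x ord0 j)%R @^-1` [set 0%R])).
    apply: measurableC; apply: fin_bigcap_measurable => // j _.
    rewrite -[X in measurable X]setTI.
    by apply: (measurable_funB (mu j) (mv j)).
  congr (~` _); apply/seteqP; split => x.
    by move=> uvx j _ /=; rewrite uvx subrr.
  by move=> H; apply/rowP => j; apply/eqP; rewrite -subr_eq0; apply/eqP; exact: H.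
pose M := (`|nu| * (2 ^+ s * t) `^ p + `|c|)%R.
have M0 : (0 <= M)%R by rewrite addr_ge0// mulr_ge0// powR_ge0.
have mwp : measurable_fun [set: L] (fun x => enorm (u x) `^ p)%R.
  exact: (measurableT_comp (measurable_powR p)).
have mexc : measurable_fun [set: L]
    (fun x => enorm (u x) `^ p * (2 ^+ s * t < enorm (u x))%R%:R)%R.
  apply: (measurable_funM mwp).
  have -> : (fun x : L => (2 ^+ s * t < enorm (u x))%R%:R : R) =
      \1_((fun x : L => enorm (u x)) @^-1` `](2 ^+ s * t)%R, +oo[%classic).
    apply/funext => x; rewrite indicE; congr (_%:R); congr nat_of_bool.
    by apply/idP/idP => [tw|]; rewrite ?inE/= ?in_itv/= ?andbT.
  apply: measurable_indic; rewrite -[X in measurable X]setTI.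
  by apply: mw; [exact: measurableT|exact: measurable_itv].
have PT : P [set: L] < +oo by rewrite torus_measureT ltry.
have main : \int[P]_x (enorm (u x) `^ p * (2 ^+ s * t < enorm (u x))%R%:R)%:E <= M%:E * P D.
  apply: (@integral_le_off_contact _ _ _ P (fun x : L => f x (u x))
    (fun x : L => f x (v x))).
  - exact: PT.
  - exact: mD.
  - exact: mf.
  - exact: mf.
  - exact: mexc.
  - by move=> x; rewrite mulr_ge0 ?powR_ge0.
  - exact: M0.
  - exact: fv.
  - apply: filterS f_growth => x fx; apply: le_trans (fx (u x)).1.
    by rewrite -[leRHS]mulr1 ler_wpM2l ?powR_ge0//; case: (_ < _)%R.
  - apply: filterS vb => x vx; case: ltP => [ux _ uvx|]; last by rewrite mulr0 eqxx.
    by move: ux; rewrite uvx ltNge vx.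
  - by move=> x /= uvx; congr (f x _); exact: contrapT.
  - exact: fuv.
(* The set of difference lies in [F] only up to a null set, so indicators are compared almost
   everywhere. *)
have PD : P D <= lebesgue_rV R n F.
  apply: le_trans (torus_measure_le mF).
  have iE (S : set L) : measurable S -> P S = \int[P]_x (\1_S x)%:E.
    by move=> mS; rewrite integral_indic// setIT.
  rewrite (iE D)// (iE F)//; apply: ae_ge0_le_integral.
  - exact: measurableT.
  - by move=> x _; rewrite lee_fin.
  - by apply/measurable_EFinP; exact: measurable_indic.
  - by move=> x _; rewrite lee_fin.
  - by apply/measurable_EFinP; exact: measurable_indic.
  apply: filterS2 uv (ae_unit_cube n) => x uvx Qx _; rewrite lee_fin !indicE ler_nat.
  have [/set_mem Dx|//] := boolP (x \in D).
  by rewrite mem_set//; apply: uF => //; exact: uvx.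
apply: (le_trans main).
have pt : (t `^ p = t * t `^ (p - 1))%R by rewrite mulr_powRB1// ltW.
have Mt : (M <= (`|nu| * (2 ^+ s) `^ p + 1) * t `^ p)%R.
  rewrite /M powRM ?exprn_ge0 ?(ltW t0)// mulrDl mulrA mul1r lerD2l.
  by rewrite (le_trans ct)// le1r_powR// ltW.
set a := (`|nu| * (2 ^+ s) `^ p + 1)%R in Mt *.
have a0 : (0 <= a)%R by rewrite addr_ge0// mulr_ge0// powR_ge0.
apply: (@le_trans _ _ ((a * t `^ p)%:E * P D)).
  by apply: lee_wpmul2r; rewrite ?lee_fin.
(* A factor 4t is split off to pair with the measure of [F]; the 4 cancels the one in the weak-type
   constant. *)
rewrite pt (_ : a * (t * t `^ (p - 1)) = (a * t `^ (p - 1) / 4) * (4 * t))%R; last by field.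
rewrite EFinM -muleA.
apply: (@le_trans _ _ ((a * t `^ (p - 1) / 4)%:E * ((4 * (42 * n%:R) ^+ n)%:E * E))).
  apply: lee_wpmul2l; first by rewrite lee_fin divr_ge0// mulr_ge0// powR_ge0.
  by apply: le_trans FE; apply: lee_wpmul2l => //; rewrite lee_fin ltW.
rewrite muleA -EFinM le_eqVlt; apply/orP; left; apply/eqP; congr (_%:E * _).
by set X := ((42 * n%:R) ^+ n)%R; field.
Qed.

End minimisers.

(** The order of quantifiers expresses uniformity: [eps0] precedes the operator, [c], [f] and [u],
    and is built from [n], [p], [C] and [nu]. *)
Theorem theorem1p2 (R : realType) (n m l : nat) (n_gt0 : (0 < n)%N)
    (p C nu : R) (p_gt1 : 1 < p) :
  exists2 eps0 : R, 0 < eps0 &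
  forall (k : nat) (A : diff_op R n m l k) (c : R)
    (f : 'rV[R]_n -> 'rV[R]_m -> R),
  torus_periodic f -> integrand_measurable f ->
  {ae torus_measure R n, forall x : lebesgue_rV_type R n,
    forall w : 'rV[R]_m,
      enorm w `^ p <= f x w /\ f x w <= nu * enorm w `^ p + c} ->
  truncation_property A p C ->
  forall u : 'rV[R]_n -> 'rV[R]_m, minimiser A f p u ->
  forall eps : R, 0 < eps < eps0 -> in_Lp (p + eps)%:E u.
Proof.
have p0 : 0 < p by exact: lt_trans p_gt1.
pose s := (Num.truncn (4 * `|C|)).+1.
have Cs : 4 * `|C| <= 2 ^+ s.
  apply: (@le_trans _ _ s%:R); first exact/ltW/truncnS_gt.
  by rewrite -natrX ler_nat ltnW// ltn_expl.
pose K : R := (`|nu| * (2 ^+ s) `^ p + 1) * (42 * n%:R) ^+ n.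
have K0 : 0 <= K.
  apply: mulr_ge0; last by rewrite exprn_ge0// mulr_ge0.
  by rewrite addr_ge0// mulr_ge0// powR_ge0.
have b1 : 1 < 2 `^ (p - 1) :> R.
  rewrite -[ltLHS](powRr0 2) /powR gt_eqF// ltr_expR mul0r mulr_gt0 ?subr_gt0//.
  by rewrite ln_gt0// ltr1n.
pose B : R := 2 `^ (p - 1) / (2 `^ (p - 1) - 1).
have B0 : 0 <= B by rewrite divr_ge0 ?powR_ge0// subr_ge0 ltW.
pose G := K * B * 2 ^+ s.
have G0 : 0 <= G by apply: mulr_ge0; [exact: mulr_ge0|exact: exprn_ge0].
have G1 : 0 < 8 * G + 1 by rewrite ltr_wpDl// mulr_ge0.
(* The cap 1 gives e <= 2, hence e^s <= 2^s and e - 1 <= 4 eps; then 8 eps G < 1 makes the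
   absorption constant at most 1/2. *)
exists (Num.min 1 (8 * G + 1)^-1); first by rewrite lt_min ltr01 invr_gt0.
move=> k A c f _ mf fg TP u um eps /andP[eps0].
rewrite lt_min => /andP[eps1 epsG].
have [t0 t00 Ht] := level_estimate n_gt0 p_gt1 mf fg TP um Cs.
have [[pu mu /Lp_norm_lty up] _] := um.
have {}up := up (negbT (gt_eqF p0)).
split => //; apply/Lp_norm_lty; first by rewrite gt_eqF// addr_gt0.
have mw : measurable_fun [set: lebesgue_rV_type R n] (fun x => enorm (u x)).
  exact: measurable_enorm.
apply: (self_improvement mw (fun x => enorm_ge0 _) p_gt1 eps0 t00 K0 up Ht).
set e := 2 `^ eps.
have e2 : e <= 2 by rewrite -[leRHS]powRr1// ler_powR ?ler1n// ltW.
have e0 : 0 < e by rewrite powR_gt0.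
have e1 : 1 <= e by rewrite -[leLHS](powRr0 2); apply: ler_powR; rewrite ?ler1n// ltW.
have e4 : e - 1 <= 4 * eps.
  have ln2 : ln 2 < 2 :> R by exact: ln_sublinear.
  (* The tangent line of the exponential bounds 2^(-eps) from below; multiplied by [e], it gives e -
     1 <= eps e ln 2. *)
  have : 1 - eps * ln 2 <= e^-1.
    rewrite -powRN /powR gt_eqF// mulNr; exact: expR_ge1Dx.
  rewrite -(ler_pM2l e0) mulfV ?gt_eqF// mulrBr mulr1 lerBlDr => /le_trans le_e.
  rewrite lerBlDl; apply: le_e; rewrite lerD2l mulrCA.
  have : e * ln 2 <= 2 * 2 by rewrite ler_pM ?(ltW e0) ?(ltW ln2)// ln_ge0// ler1n.
  by move=> h; rewrite mulrC ler_wpM2r ?(ltW eps0)// (le_trans h)// -natrM.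
rewrite -/B; apply: (@le_trans _ _ (4 * eps * G)).
  apply: ler_pM => //; first by rewrite subr_ge0.
    by apply: mulr_ge0; [exact: mulr_ge0|exact/exprn_ge0/ltW].
  apply: ler_wpM2l; first exact: mulr_ge0.
  by rewrite lerXn2r ?nnegrE ?(ltW e0).
have : eps * (8 * G + 1) < 1 by rewrite -ltr_pdivlMr// mul1r.
by rewrite mulrDr; move: eps0; lra.
Qed.
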